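(* Let $D=\mathcal{C}_1\cup_P\cdots\cup_P\mathcal{C}_n$ be a weighted oriented graph consisting of cycles $\mathcal{C}_1,\ldots,\mathcal{C}_n$ that share a path $P$ such that at most two of these cycles are unbalanced. Then the following are equivalent: (i) $I_D$ is strongly robust; (ii) $I_D$ is robust; (iii) $I_D$ is generalized robust; (iv) $I_D$ is weakly robust; (v) $D$ has no subgraph of type $D_1$ and no subgraph of type $D_2$.
   Context: A weighted oriented graph $D=(V(D),E(D),\mathbf{w})$ has a finite simple underlying graph (no loops, no multiple edges) with $V(D)=\{x_1,\dots,x_p\}$; each edge is an ordered pair $(x_i,x_j)$ oriented from its tail $x_i$ to its head $x_j$; $\mathbf{w}:V(D)\to\mathbb{N}=\{1,2,\dots\}$ is a weight function, $w_i=\mathbf{w}(x_i)$. Let $K$ be a field. The toric ideal $I_D\subset K[e:e\in E(D)]$ is the kernel of the $K$-algebra homomorphism $K[e:e\in E(D)]\to K[x_1,\dots,x_p]$ sending the variable $e=(x_i,x_j)$ to $x_ix_j^{w_j}$. The incidence matrix $A(D)$ has rows indexed by vertices and columns by edges; the entry at (vertex $x_i$, edge $e$) is $1$ if $x_i$ is the tail of $e$, $w_i$ if $x_i$ is the head of $e$, and $0$ otherwise. Subgraphs (not necessarily induced; in particular cycles, which are cycles of the underlying undirected graph) carry the inherited orientation and weights. Binomials are identified with their negatives. A binomial $\mathbf{e}^{\mathbf{u}}-\mathbf{e}^{\mathbf{v}}\in I_D$ is primitive if there is no other binomial $\mathbf{e}^{\mathbf{u}'}-\mathbf{e}^{\mathbf{v}'}\in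 I_D$ (nonzero) with $\mathbf{e}^{\mathbf{u}'}\mid\mathbf{e}^{\mathbf{u}}$ and $\mathbf{e}^{\mathbf{v}'}\mid\mathbf{e}^{\mathbf{v}}$. $Gr_D$ (Graver basis) is the set of primitive binomials of $I_D$; $\mathcal{U}_D$ (universal Gröbner basis) is the union of all reduced Gröbner bases of $I_D$ over all term orders; $\mathcal{M}_D$ (universal Markov basis) is the union of all minimal binomial generating sets of $I_D$. The ideal $I_D$ is strongly robust if $Gr_D$ is a minimal generating set of $I_D$; robust if $\mathcal{U}_D$ is a minimal generating set of $I_D$; generalized robust if $\mathcal{U}_D=\mathcal{M}_D$; weakly robust if $Gr_D=\mathcal{M}_D$. The notation $D=\mathcal{C}_1\cup_P\cdots\cup_P\mathcal{C}_n$ means that $D$ is the union of the cycles $\mathcal{C}_1,\dots,\mathcal{C}_n$, that $P$ is a path of length (number of edges) at least $1$ contained in every $\mathcal{C}_i$, with $E(\mathcal{C}_i)\ne E(P)$, and that any two distinct cycles intersect exactly in $P$ (both in vertices and edges). A cycle $\mathcal{C}$ is balanced if $\det A(\mathcal{C})=0$ and unbalanced otherwise. Cycles share an edge $e$ means that any two of them intersect exactly in $e$ and its two end vertices. A weighted oriented graph is of type $D_1$ if it consists of two balanced cycles that share an edge $e$. It is of type $D_2$ if it consists of three cycles $\mathcal{B},\mathcal{C}',\mathcal{C}''$ that share an edge $e$, where $\mathcal{B}$ is balanced, $\mathcal{C}'$ and $\mathcal{C}''$ are unbalanced, and the cycle $\mathcal{C}'''$ with edge set $(E(\mathcal{C}')\cup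 E(\mathcal{C}''))\setminus\{e\}$ is also unbalanced. *)

(* Defs.v *)
From HB Require Import structures.
From mathcomp Require Import all_boot all_order all_algebra.
From mathcomp Require Import mpoly.

Set Implicit Arguments.
Unset Strict Implicit.
Unset Printing Implicit Defensive.

Import GRing.Theory.

Local Open Scope ring_scope.

(* The edges are enumerated as e_0, ..., e_(q-1), so that K[e : e in E(D)] is
   {mpoly K[q]}; [ends_inj] says that distinct indices carry distinct unordered
   pairs, i.e. the underlying graph has no multiple edges. *)
Record wograph := WOGraph {
  nvert : nat;
  nedge : nat;
  tail_of : 'I_nedge -> 'I_nvert;
  head_of : 'I_nedge -> 'I_nvert;
  weight : 'I_nvert -> nat;
  loopless : forall e, tail_of e != head_of e;
  ends_inj : injective (fun e => [set tail_of e; head_of e]);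
  weight_gt0 : forall x, (0 < weight x)%N
}.

Section Subgraphs.

Variable D : wograph.

Definition ends (e : 'I_(nedge D)) : {set 'I_(nvert D)} := [set tail_of e; head_of e].

Record subgraph := Subgraph {
  verts : {set 'I_(nvert D)};
  edges : {set 'I_(nedge D)};
  ends_sub : forall e, e \in edges -> ends e \subset verts
}.

Implicit Types (H P C : subgraph) (e : 'I_(nedge D)).

Definition is_cycle C : Prop :=
  exists s : seq 'I_(nvert D),
    [/\ (2 < size s)%N, uniq s, verts C = [set x in s] &
        [set ends e | e in edges C] = [set [set x; next s x] | x in s]].

(* paths with at least one edge *)
Definition is_path P : Prop :=
  exists s : seq 'I_(nvert D),
    [/\ (1 < size s)%N, uniq s, verts P = [set x in s] &
        [set ends e | e in edges P] =
        [set [set u.1; u.2] | u in zip s (behead s)]].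

Definition contained H1 H2 : Prop :=
  verts H1 \subset verts H2 /\ edges H1 \subset edges H2.

Definition incidence_mx H : 'M[int]_(#|verts H|, #|edges H|) :=
  \matrix_(i, j)
    let x := enum_val i in let e := enum_val j in
    if x == tail_of e then 1
    else if x == head_of e then (weight x)%:Z else 0.

(* [balanced] is only meaningful for cycles, where #|verts C| = #|edges C| and
   [conform_mx] is a mere cast; vanishing of the determinant does not depend on
   the enumerations of the vertices and edges. *)
Definition balanced C : bool :=
  \det (conform_mx (1%:M : 'M[int]_#|verts C|) (incidence_mx C)) == 0.

(* D = C_1 \cup_P ... \cup_P C_n *)
Definition union_along_path (n : nat) P (C : 'I_n -> subgraph) : Prop :=
  [/\ forall i, is_cycle (C i),
      \bigcup_i verts (C i) = [set: 'I_(nvert D)] /\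
      \bigcup_i edges (C i) = [set: 'I_(nedge D)],
      is_path P,
      forall i, contained P (C i) /\ edges (C i) != edges P &
      forall i j, i != j ->
        verts (C i) :&: verts (C j) = verts P /\
        edges (C i) :&: edges (C j) = edges P].

Definition share_edge e C1 C2 : Prop :=
  verts C1 :&: verts C2 = ends e /\ edges C1 :&: edges C2 = [set e].

Definition type_D1 H : Prop :=
  exists e B1 B2,
    [/\ is_cycle B1 /\ balanced B1,
        is_cycle B2 /\ balanced B2,
        share_edge e B1 B2,
        verts H = verts B1 :|: verts B2 &
        edges H = edges B1 :|: edges B2].

Definition type_D2 H : Prop :=
  exists e B C' C'' C''',
    [/\ [/\ is_cycle B & balanced B],
        [/\ is_cycle C', ~~ balanced C', is_cycle C'' & ~~ balanced C''],
        [/\ share_edge e B C', share_edge e B C'' & share_edge e C' C''],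
        [/\ is_cycle C''', edges C''' = (edges C' :|: edges C'') :\ e &
            ~~ balanced C'''] &
        verts H = verts B :|: verts C' :|: verts C'' /\
        edges H = edges B :|: edges C' :|: edges C''].

End Subgraphs.

Section PolynomialIdeals.

Variables (K : fieldType) (n : nat).

Local Notation S := {mpoly K[n]}.

Implicit Types (I : S -> Prop) (f g h : S) (m u v : 'X_{1..n}).

Definition ideal_gen (G : S -> Prop) f : Prop :=
  exists s : seq (S * S),
    (forall t, t \in s -> G t.2) /\ f = \sum_(t <- s) t.1 * t.2.

Definition generates (G I : S -> Prop) : Prop := forall f, ideal_gen G f <-> I f.

(* Binomials are identified with their negatives, so a set of binomials is
   encoded as a set of polynomials stable under negation. *)
Definition sign_closed (G : S -> Prop) : Prop := forall f, G f -> G (- f).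

Definition min_gen_set (G I : S -> Prop) : Prop :=
  [/\ sign_closed G, generates G I &
      forall G', sign_closed G' -> (forall f, G' f -> G f) ->
        generates G' I -> forall f, G f -> G' f].

Definition is_binomial f : Prop :=
  exists u v, u != v /\ f = 'X_[u] - 'X_[v].

(* (u' <= u)%MM is the componentwise order, i.e. divisibility of monomials. *)
Definition graver I f : Prop :=
  exists u v,
    [/\ u != v, f = 'X_[u] - 'X_[v], I f &
        forall u' v', u' != v' -> I ('X_[u'] - 'X_[v']) ->
          (u' <= u)%MM -> (v' <= v)%MM -> u' = u /\ v' = v].

Definition universal_markov I f : Prop :=
  exists G : S -> Prop, [/\ forall g, G g -> is_binomial g, min_gen_set G I & G f].

Definition term_order (le : rel 'X_{1..n}) : Prop :=
  [/\ total le, antisymmetric le, transitive le,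
      forall m, le 0%MM m &
      forall m u v, le u v -> le (u + m)%MM (v + m)%MM].

Definition lead_monom (le : rel 'X_{1..n}) f m : Prop :=
  m \in msupp f /\ forall m', m' \in msupp f -> le m' m.

Definition initial_ideal (le : rel 'X_{1..n}) (G : S -> Prop) : S -> Prop :=
  ideal_gen (fun h => exists g m, [/\ G g, lead_monom le g m & h = 'X_[m]]).

Definition groebner_basis (le : rel 'X_{1..n}) I (G : seq S) : Prop :=
  (forall g, g \in G -> I g) /\
  (forall h, initial_ideal le (fun g => g \in G) h <-> initial_ideal le I h).

Definition reduced_groebner_basis (le : rel 'X_{1..n}) I (G : seq S) : Prop :=
  groebner_basis le I G /\
  forall g, g \in G ->
    (exists m, lead_monom le g m /\ g@_m = 1) /\
    (forall g' m' m, g' \in G -> g' != g -> lead_monom le g' m' ->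
       m \in msupp g -> ~~ (m' <= m)%MM).

Definition universal_groebner I f : Prop :=
  exists (le : rel 'X_{1..n}) (G : seq S),
    [/\ term_order le, reduced_groebner_basis le I G & f \in G \/ - f \in G].

End PolynomialIdeals.

Section ToricIdeal.

Variables (K : fieldType) (D : wograph).

Definition toric_ideal (f : {mpoly K[nedge D]}) : Prop :=
  f \mPo [tuple 'X_(tail_of e) * 'X_(head_of e) ^+ weight (head_of e) | e < nedge D]
    = 0 :> {mpoly K[nvert D]}.

Definition strongly_robust : Prop :=
  min_gen_set (graver toric_ideal) toric_ideal.

Definition robust : Prop :=
  min_gen_set (universal_groebner toric_ideal) toric_ideal.

Definition generalized_robust : Prop :=
  forall f, universal_groebner toric_ideal f <-> universal_markov toric_ideal f.

Definition weakly_robust : Prop :=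
  forall f, graver toric_ideal f <-> universal_markov toric_ideal f.

End ToricIdeal.

(* Main.v *)
Require Import Defs.
From HB Require Import structures.
From Stdlib Require Import Classical.
From mathcomp Require Import all_boot all_order all_algebra.
From mathcomp Require Import mpoly ring lra zify.

Set Implicit Arguments.
Unset Strict Implicit.
Unset Printing Implicit Defensive.

Import Order.TTheory GRing.Theory Num.Theory.

Local Open Scope ring_scope.

(* A fiber consists of the monomials with a given image under the toric map. If the
   fiber of every primitive binomial [X_u - X_v] is just [{u, v}], then, up to sign,
   every primitive binomial belongs to every binomial generating set and to every
   reduced Groebner basis, so the Graver basis, the universal Groebner basis and
   the universal Markov basis coincide and generate minimally. If on the contrary
   a circuit [X_u - X_v] has a third monomial [w] in its fiber which shares
   variables with both [u] and [v], then it is in the universal Groebner basis but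
   never in a minimal generating set, and all four robustness properties fail.

   A strand is one of the n + 1 internally disjoint paths with common end points
   [a] and [b] making up [D]. On a strand, the vectors killed by the interior rows
   of the incidence matrix form a line, alternate in sign, and have a slope: the
   ratio of their images at [b] and [a]. Two strands form a balanced cycle iff
   their slopes agree. Strands with an interior vertex carry both signs, so a third
   monomial in a primitive fiber requires opposite signs on a strand that is a
   single edge [e], and the vanishing at [a] and [b] rules this out when all
   strands but [e] and one other have a common slope different from that of [e].
   Under the hypothesis on the unbalanced cycles the pattern fails only for [D_1]
   and [D_2]. There the balanced cycle through [e] gives [w]: its path [B - e] acts
   at the ends of [e] like an integral multiple of [e], as the tail of [e] has
   coefficient 1, so that in [u] the part on [B - e] can be traded for copies of
   [e]. *)

(** * Ideals and projections onto sets of monomials *)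

Section IdealGen.

Variables (K : fieldType) (n : nat).
Implicit Types (f g h : {mpoly K[n]}) (m u v : 'X_{1..n}).
Implicit Types (G : {mpoly K[n]} -> Prop) (T : pred 'X_{1..n}).

Lemma ideal_gen0 G : ideal_gen G 0.
Proof. by exists [::]; split=> //; rewrite big_nil. Qed.

Lemma ideal_genD G f g : ideal_gen G f -> ideal_gen G g -> ideal_gen G (f + g).
Proof.
move=> [s [sG ->]] [t [tG ->]]; exists (s ++ t); split; last by rewrite big_cat.
by move=> x; rewrite mem_cat => /orP[/sG|/tG].
Qed.

Lemma ideal_genM G p f : ideal_gen G f -> ideal_gen G (p * f).
Proof.
move=> [s [sG ->]]; exists [seq (p * t.1, t.2) | t <- s]; split.
  by move=> _ /mapP[t ts ->] /=; apply: sG.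
by rewrite big_map mulr_sumr; apply: eq_bigr => t _; rewrite mulrA.
Qed.

Lemma ideal_gen_mem G f : G f -> ideal_gen G f.
Proof.
by move=> Gf; exists [:: (1, f)]; split; [move=> t; rewrite inE => /eqP-> | rewrite big_seq1 mul1r].
Qed.

Lemma ideal_genN G f : ideal_gen G f -> ideal_gen G (- f).
Proof. by rewrite -mulN1r; apply: ideal_genM. Qed.

Lemma ideal_gen_le G G' f :
  (forall g, G g -> ideal_gen G' g) -> ideal_gen G f -> ideal_gen G' f.
Proof.
move=> GG' [s [sG ->]]; elim: s sG => [|t s IHs] sG.
  by rewrite big_nil; apply: ideal_gen0.
rewrite big_cons; apply: ideal_genD; last first.
  by apply: IHs => x xs; apply: sG; rewrite inE xs orbT.
by apply/ideal_genM/GG'/sG; rewrite inE eqxx.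
Qed.

Definition restr T f := \sum_(m <- msupp f | T m) f@_m *: 'X_[m].

Lemma mcoeff_restr T f m : (restr T f)@_m = if T m then f@_m else 0.
Proof.
rewrite raddf_sum /=.
have [mf|mf] := boolP (m \in msupp f); last first.
  rewrite (memN_msupp_eq0 mf) if_same big_seq_cond big1 // => k /andP[kf _].
  by rewrite mcoeffZ mcoeffX; case: eqP kf mf => [->->//|]; rewrite mulr0.
rewrite big_mkcond (bigD1_seq m) ?msupp_uniq //= big1 => [|k km].
  by rewrite addr0; case: ifP => // _; rewrite mcoeffZ mcoeffX eqxx mulr1.
by case: ifP => // _; rewrite mcoeffZ mcoeffX (negPf km) mulr0.
Qed.

Lemma restr_is_linear T : linear (restr T).
Proof.
move=> c f g; apply/mpolyP => m.
by rewrite mcoeffD mcoeffZ !mcoeff_restr mcoeffD mcoeffZ; case: ifP; rewrite ?mulr0 ?addr0.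
Qed.

HB.instance Definition _ T := GRing.isLinear.Build K {mpoly K[n]} {mpoly K[n]} _
  (restr T) (restr_is_linear T).

Lemma restr_id T f : (forall m, m \in msupp f -> T m) -> restr T f = f.
Proof.
move=> Tf; apply/mpolyP => m; rewrite mcoeff_restr; case: ifP => // /negP Tm.
by rewrite memN_msupp_eq0 //; apply/negP => /Tf.
Qed.

Lemma restr_eq0 T f : (forall m, m \in msupp f -> ~~ T m) -> restr T f = 0.
Proof.
move=> Tf; apply/mpolyP => m; rewrite mcoeff_restr mcoeff0; case: ifP => // Tm.
by rewrite memN_msupp_eq0 //; apply/negP => /Tf/negP.
Qed.

(** For each monomial [c] of [p], the product of [X_c] with [g] lies entirely inside [T] or entirely
    outside it, so the restriction only selects terms of [p]. *)
Lemma restrM T T' p g :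
    (forall c m, m \in msupp g -> T (c + m)%MM = T' c) ->
  restr T (p * g) = restr T' p * g.
Proof.
move=> TT'; rewrite [in LHS](mpolyE p) mulr_suml linear_sum mulr_suml.
rewrite [RHS]big_mkcond; apply: eq_bigr => c _ /=; rewrite -scalerAl linearZ /=.
have suppE m : m \in msupp ('X_[c] * g) -> exists2 m', m' \in msupp g & m = (c + m')%MM.
  by rewrite -commr_mpolyX (perm_mem (msuppMX _ _)) => /mapP.
case: ifP => T'c.
  by rewrite restr_id ?scalerAl // => m /suppE[m' m'g ->]; rewrite TT'.
by rewrite restr_eq0 ?scaler0 // => m /suppE[m' m'g ->]; rewrite TT' ?T'c.
Qed.

(** When no monomial multiple of a generator straddles the border of [T], restriction turns a
    combination of generators into another one, and generators without a multiple in [T] drop out.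
    It is applied to fibers and to single monomials. *)
Lemma ideal_gen_restr G T f :
    (forall g c m m', G g -> m \in msupp g -> m' \in msupp g ->
       T (c + m)%MM = T (c + m')%MM) ->
    ideal_gen G f ->
  ideal_gen (fun g => G g /\ exists c m, m \in msupp g /\ T (c + m)%MM) (restr T f).
Proof.
move=> TG [s [sG ->]]; elim: s sG => [|t s IHs] sG.
  by rewrite big_nil linear0; apply: ideal_gen0.
rewrite big_cons linearD /=; apply: ideal_genD; last first.
  by apply: IHs => x xs; apply: sG; rewrite inE xs orbT.
have {IHs}Gt : G t.2 by apply: sG; rewrite inE eqxx.
case Es: (msupp t.2) => [|m0 s0].
  by rewrite (msuppnil0 Es) mulr0 linear0; apply: ideal_gen0.
have m0t : m0 \in msupp t.2 by rewrite Es inE eqxx.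
rewrite (restrM (T' := fun c => T (c + m0)%MM)); last first.
  by move=> c m mt; apply: TG Gt mt m0t.
have [[c Tc]|noT] := classic (exists c, T (c + m0)%MM).
  by apply/ideal_genM/ideal_gen_mem; split=> //; exists c, m0.
rewrite restr_eq0 ?mul0r; first exact: ideal_gen0.
by move=> c _; apply/negP => Tc; case: noT; exists c.
Qed.

(** Restriction to the single monomial [u] keeps only generators dividing [X_u]; were there none,
    [X_u] would be zero. *)
Lemma mem_monomial_ideal (P : 'X_{1..n} -> Prop) G u :
    (forall g, G g -> exists2 m, P m & g = 'X_[m]) ->
  ideal_gen G 'X_[u] -> exists2 m, P m & (m <= u)%MM.
Proof.
move=> GP Gu; case: (ideal_gen_restr (T := pred1 u) _ Gu) => [g c m m' /GP[k _ ->]|].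
  by rewrite !msuppX !inE => /eqP-> /eqP->.
move=> [|t s] [sG E].
  move/mpolyP/(_ u): E; rewrite big_nil mcoeff_restr mcoeff0 /= eqxx mcoeffX eqxx.
  by move/eqP; rewrite oner_eq0.
case: (sG t); first by rewrite inE eqxx.
move=> /GP[m Pm ->] [c [m' []]]; rewrite msuppX inE => /eqP-> /eqP <-.
by exists m => //; apply: lem_addl.
Qed.

End IdealGen.

(* Induction on the number [k] of compared coordinates: a basis [s] for the
   first [k] coordinates covers every monomial whose coordinate [k] exceeds a
   bound for [s], and each of the finitely many smaller values of that coordinate
   is covered separately. *)
Lemma dickson (n : nat) (P : 'X_{1..n} -> Prop) :
  exists s : seq 'X_{1..n},
    (forall m, m \in s -> P m) /\
    (forall m, P m -> exists2 m', m' \in s & (m' <= m)%MM).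
Proof.
suff H k : (k <= n)%N -> forall P : 'X_{1..n} -> Prop, exists s : seq 'X_{1..n},
    (forall m, m \in s -> P m) /\ (forall m, P m -> exists2 m', m' \in s &
      forall i : 'I_n, (i < k)%N -> (m' i <= m i)%N).
  have [s [sP Ps]] := H n (leqnn n) P; exists s; split=> // m /Ps[m' m's le].
  by exists m' => //; apply/mnm_lepP => i; apply: le.
elim: k => [|k IHk] kn {}P.
  have [[m Pm]|noP] := classic (exists m, P m); last first.
    by exists [::]; split=> // m Pm; case: noP; exists m.
  exists [:: m]; split=> [m'|m' _]; first by rewrite inE => /eqP->.
  by exists m; rewrite ?inE ?eqxx.
have [s0 [s0P Ps0]] := IHk (ltnW kn) P.
pose o := Ordinal kn; pose N := (\max_(m <- s0) (m o))%N.
have [s1 [s1P Ps1]] : exists s : seq 'X_{1..n},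
    (forall m, m \in s -> P m) /\ (forall m, P m -> (m o < N)%N ->
       exists2 m', m' \in s & forall i : 'I_n, (i < k.+1)%N -> (m' i <= m i)%N).
  elim: {s0 s0P Ps0} N => [|N [s [sP Ps]]]; first by exists [::].
  have [t [tP Pt]] := IHk (ltnW kn) (fun m => P m /\ m o = N).
  exists (t ++ s); split=> [m|m Pm].
    by rewrite mem_cat => /orP[/tP[]|/sP].
  rewrite ltnS leq_eqVlt => /orP[/eqP mN|/(Ps _ Pm)[m' m's le]]; last first.
    by exists m' => //; rewrite mem_cat m's orbT.
  have [m' m't le] := Pt m (conj Pm mN); have [_ m'N] := tP m' m't.
  exists m' => [|i]; first by rewrite mem_cat m't.
  rewrite ltnS leq_eqVlt => /orP[/eqP ik|/le//].
  by rewrite (_ : i = o) ?mN ?m'N //; apply: val_inj.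
exists (s0 ++ s1); split=> [m|m Pm].
  by rewrite mem_cat => /orP[/s0P|/s1P].
have [/(Ps1 _ Pm)[m' m's le]|Nm] := ltnP (m o) N.
  by exists m' => //; rewrite mem_cat m's orbT.
have [m' m's le] := Ps0 _ Pm; exists m' => [|i]; first by rewrite mem_cat m's.
rewrite ltnS leq_eqVlt => /orP[/eqP ik|/le//].
rewrite (_ : i = o); last exact: val_inj.
apply: leq_trans Nm; rewrite /N; elim: (s0) m's => // x t IHt.
by rewrite inE big_cons leq_max => /orP[/eqP<-|/IHt->]; rewrite ?leqnn ?orbT.
Qed.

Definition mmask (n : nat) (b : pred 'I_n) (m : 'X_{1..n}) : 'X_{1..n} :=
  [multinom if b i then m i else 0%N | i < n].

(** An elimination order: monomials that involve a variable of [b] exceed all those that do not.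
    Equal parts on [b] are compared by the ambient monomial order. *)
Definition block_le (n : nat) (b : pred 'I_n) : rel 'X_{1..n} := fun m1 m2 =>
  (mmask b m1 < mmask b m2)%O || (mmask b m1 == mmask b m2) && (m1 <= m2)%O.

Lemma block_le_term_order (n : nat) (b : pred 'I_n) : term_order (block_le b).
Proof.
rewrite /block_le; set r := mmask b.
have rD m1 m2 : r (m1 + m2)%MM = (r m1 + r m2)%MM.
  by apply/mnmP => i; rewrite mnmDE !mnmE; case: ifP; rewrite ?mnmDE.
split.
- by move=> m1 m2; case: (ltgtP (r m1) (r m2)) => //= _; apply: le_total.
- move=> m1 m2; case: (ltgtP (r m1) (r m2)) => //= _; exact: le_anti.
- move=> m2 m1 m3 /orP[lt12|/andP[/eqP-> le12]] /orP[lt23|/andP[/eqP<- le23]].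
  + by rewrite (lt_trans lt12 lt23).
  + by rewrite lt12.
  + by rewrite lt23.
  + by rewrite eqxx (le_trans le12 le23) orbT.
- move=> m; have -> : r 0%MM = 0%MM by apply/mnmP => i; rewrite mnmE mnm0E if_same.
  by have:= le0m (r m); rewrite le_eqVlt eq_sym => /orP[/eqP->|->//]; rewrite eqxx le0m orbT.
- by move=> m u v; rewrite !rD ltmc_add2l lemc_add2l eqm_add2r.
Qed.

(** * Fibers of the degree map *)

Section Toric.

Variables (K : fieldType) (q p : nat) (A : 'I_q -> 'X_{1..p}).
Hypothesis A_neq0 : forall e, A e != 0%MM.

Local Notation S := {mpoly K[q]}.
Implicit Types (f g h : S) (m u v w : 'X_{1..q}).

(** The exponent of the image of [X_m] under the toric map; its level sets are the fibers. *)
Definition adeg m : 'X_{1..p} := (\sum_e A e *+ m e)%MM.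

Definition toric f : Prop := f \mPo [tuple 'X_[A e] | e < q] = 0 :> {mpoly K[p]}.

Lemma adegD m u : adeg (m + u)%MM = (adeg m + adeg u)%MM.
Proof.
rewrite /adeg -big_split /=; apply: eq_bigr => e _.
by apply/mnmP => i; rewrite mulmnE mnmDE mulnDr mnmDE !mulmnE.
Qed.

Lemma adeg_eq0 m : (adeg m == 0%MM) = (m == 0%MM).
Proof.
apply/eqP/eqP => [m0|->]; last first.
  by rewrite /adeg big1 // => e _; rewrite mnm0E mulm0n.
apply/mnmP => e; rewrite mnm0E; apply/eqP; rewrite -leqn0 leqNgt; apply/negP => me.
case/negP: (A_neq0 e); move: m0 => /(congr1 (@mdeg p))/eqP.
rewrite /adeg mdeg_sum mdeg0 sum_nat_eq0 => /forallP/(_ e).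
by rewrite mdegMn muln_eq0 mdeg_eq0 (gtn_eqF me) orbF.
Qed.

Lemma le_adeg_eq u v : (u <= v)%MM -> adeg u = adeg v -> u = v.
Proof.
move=> uv E; rewrite -(submK uv).
suff /eqP-> : (v - u == 0)%MM by rewrite add0m.
rewrite -adeg_eq0; apply/eqP/(@addIm _ (adeg u)).
by rewrite -adegD submK // add0m E.
Qed.

Lemma mdeg_le_adeg m : (mdeg m <= mdeg (adeg m))%N.
Proof.
rewrite /adeg mdeg_sum mdegE; apply: leq_sum => e _.
by rewrite mdegMn leq_pmull // lt0n mdeg_eq0.
Qed.

Lemma toricE f : f \mPo [tuple 'X_[A e] | e < q] =
  \sum_(m <- msupp f) f@_m *: 'X_[adeg m] :> {mpoly K[p]}.
Proof.
rewrite comp_mpolyE; apply: eq_bigr => m _; congr (_ *: _).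
by under eq_bigr do rewrite tnth_mktuple; rewrite mprodXnE.
Qed.

Lemma toricX u v : toric ('X_[u] - 'X_[v]) <-> adeg u = adeg v.
Proof.
have E m : 'X_[m] \mPo [tuple 'X_[A e] | e < q] = 'X_[adeg m] :> {mpoly K[p]}.
  by rewrite toricE msuppX big_seq1 mcoeffX eqxx scale1r.
rewrite /toric raddfB /= !E; split=> [/mpolyP/(_ (adeg u))|->]; last by rewrite subrr.
rewrite mcoeffB !mcoeffX eqxx mcoeff0; case: eqP => // _ /eqP.
by rewrite subr0 oner_eq0.
Qed.

Lemma toricB f g : toric f -> toric g -> toric (f - g).
Proof. by rewrite /toric raddfB /= => -> ->; rewrite subrr. Qed.

Lemma toricZ c f : toric f -> toric (c *: f).
Proof. by rewrite /toric linearZ /= => ->; rewrite scaler0. Qed.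

Lemma toric_gen G f : (forall g, G g -> toric g) -> ideal_gen G f -> toric f.
Proof.
move=> GI [s [sG ->]]; rewrite /toric rmorph_sum big_seq big1 // => t ts.
by rewrite rmorphM /= (GI _ (sG _ ts)) mulr0.
Qed.

(** Terms of different fibers have different images, so the terms of each fiber cancel among
    themselves, which a lone term cannot do. *)
Lemma toric_mate f m : toric f -> m \in msupp f ->
  exists m', [/\ m' \in msupp f, m' != m & adeg m' = adeg m].
Proof.
rewrite /toric toricE => f0 mf.
have [/hasP[m' m'f /andP[ne /eqP E]]|/hasPn no] :=
  boolP (has (fun m' => (m' != m) && (adeg m' == adeg m)) (msupp f)).
  by exists m'.
move/mpolyP/(_ (adeg m)): f0; rewrite raddf_sum /= mcoeff0.
rewrite (bigD1_seq m) ?msupp_uniq //= big_seq_cond big1 => [|k /andP[kf km]].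
  by rewrite addr0 mcoeffZ mcoeffX eqxx mulr1 => /eqP; rewrite mcoeff_eq0 mf.
rewrite mcoeffZ mcoeffX; have:= no k kf; rewrite km /= => /negPf->.
by rewrite mulr0.
Qed.

(** Subtracting a multiple of the binomial of two support monomials in one fiber removes one of them
    and adds no new one, so induction on the size of the support applies. *)
Lemma toric_binomial_ind (P : S -> Prop) :
    P 0 -> (forall f g, P f -> P g -> P (f + g)) ->
    (forall c u v, u != v -> adeg u = adeg v -> P (c *: ('X_[u] - 'X_[v]))) ->
  forall f, toric f -> P f.
Proof.
move=> P0 PD PX f; have [k] := ubnP (size (msupp f)); elim: k f => // k IHk f lt fI.
have [->//|] := eqVneq f 0; rewrite -msupp_eq0 => nz.
have [m mf] : exists m, m \in msupp f.
  by case: (msupp f) nz => // m s _; exists m; rewrite inE eqxx.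
have [m' [m'f ne E]] := toric_mate fI mf.
pose g := f@_m *: ('X_[m] - 'X_[m'] : S).
rewrite -[f](subrK g); apply: PD; last by apply: PX => //; rewrite eq_sym.
have gI : toric g by apply/toricZ/toricX.
apply: IHk; last exact: toricB.
apply: leq_ltn_trans (_ : (size (rem m (msupp f)) < k)%N); last first.
  by rewrite size_rem //; case: (msupp f) mf lt.
apply: uniq_leq_size; first exact: msupp_uniq.
move=> k'; rewrite mem_rem_uniq ?msupp_uniq // inE !mcoeff_msupp.
rewrite mcoeffB mcoeffZ mcoeffB !mcoeffX [m == _]eq_sym [m' == _]eq_sym.
have [->|km /=] := eqVneq k' m.
  by rewrite [m == m']eq_sym (negPf ne) subr0 mulr1 subrr eqxx.
have [-> _|k'm'] := eqVneq k' m'; first by rewrite -mcoeff_msupp.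
by rewrite subrr mulr0 subr0.
Qed.

Definition primitive u v : Prop :=
  [/\ u != v, adeg u = adeg v &
    forall u' v', u' != v' -> adeg u' = adeg v' ->
      (u' <= u)%MM -> (v' <= v)%MM -> u' = u /\ v' = v].

Lemma graverP f : graver toric f <-> exists u v, primitive u v /\ f = 'X_[u] - 'X_[v].
Proof.
split=> [[u [v [uv -> /toricX E min]]]|[u [v [[uv E min] ->]]]]; exists u, v.
  by split=> //; split=> // u' v' ne E'; apply: min => //; apply/toricX.
by split=> //; [apply/toricX | move=> u' v' ne /toricX; apply: min].
Qed.

Lemma primitive_sym u v : primitive u v -> primitive v u.
Proof.
case=> uv E min; split=> [||u' v' ne E' le1 le2]; rewrite 1?eq_sym //.
by have [] // := min v' u'; rewrite 1?eq_sym.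
Qed.

Lemma graver_sign : sign_closed (graver toric).
Proof.
move=> f /graverP[u [v [uv ->]]]; apply/graverP; exists v, u.
by rewrite opprB; split=> //; apply: primitive_sym.
Qed.

Lemma toric_graver f : graver toric f -> toric f.
Proof. by move/graverP=> [u [v [[_ E _] ->]]]; apply/toricX. Qed.

(** Induction on the total degree, splitting a nonprimitive binomial along a smaller one that
    divides it. *)
Lemma toricX_gen u v : adeg u = adeg v -> ideal_gen (graver toric) ('X_[u] - 'X_[v]).
Proof.
have [k] := ubnP (mdeg u + mdeg v)%N; elim: k u v => // k IHk u v lt E.
have [->|uv] := eqVneq u v; first by rewrite subrr; apply: ideal_gen0.
have [prim|nprim] := classic (primitive u v).
  by apply/ideal_gen_mem/graverP; exists u, v.
have [u' [v' [ne E' le1 le2 nuv]]] : exists u' v',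
    [/\ u' != v', adeg u' = adeg v', (u' <= u)%MM, (v' <= v)%MM & (u', v') != (u, v)].
  apply: NNPP => no; apply: nprim; split=> // u' v' ne E' le1 le2.
  by apply: NNPP => nE; apply: no; exists u', v'; split=> //; apply/eqP => -[? ?]; apply: nE.
have du : (mdeg u = mdeg (u - u') + mdeg u')%N by rewrite -mdegD submK.
have dv : (mdeg v = mdeg (v - v') + mdeg v')%N by rewrite -mdegD submK.
(* Both binomials on the right have smaller total degree: the first since [(u', v')] differs from
   [(u, v)], the second since [u'] and [v'] are not both trivial. *)
have -> : 'X_[u] - 'X_[v] = 'X_[u - u'] * ('X_[u'] - 'X_[v']) +
    'X_[v'] * ('X_[u - u'] - 'X_[v - v']) :> S.
  rewrite -{1}(submK le1) -{1}(submK le2) !mpolyXD; ring.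
apply: ideal_genD; apply/ideal_genM/IHk => //.
- have : (mdeg (u - u') + mdeg (v - v') != 0)%N; last by lia.
  apply: contra nuv; rewrite addn_eq0 !mdeg_eq0 => /andP[/eqP u0 /eqP v0].
  by rewrite -(submK le1) -(submK le2) u0 v0 !add0m.
- have : (mdeg u' + mdeg v' != 0)%N; last by lia.
  apply: contra ne; rewrite addn_eq0 !mdeg_eq0 => /andP[/eqP-> /eqP->].
  by rewrite eqxx.
- apply/(@addIm _ (adeg u')).
  by rewrite -adegD submK // E' -adegD submK.
Qed.

Lemma graver_generates : generates (graver toric) toric.
Proof.
move=> f; split; first exact: (toric_gen toric_graver).
elim/toric_binomial_ind; [exact: ideal_gen0|exact: ideal_genD|].
move=> c u v _ E.
by rewrite -mul_mpolyC; apply: ideal_genM; apply: toricX_gen.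
Qed.

Lemma msupp_binomial u v m : m \in msupp ('X_[u] - 'X_[v] : S) -> m = u \/ m = v.
Proof.
by move/msuppB_le; rewrite mem_cat !msuppX !inE => /orP[]/eqP->; [left|right].
Qed.

Lemma mem_msupp_binomial u v : u != v ->
  (u \in msupp ('X_[u] - 'X_[v] : S)) && (v \in msupp ('X_[u] - 'X_[v] : S)).
Proof.
move=> uv; rewrite !mcoeff_msupp !mcoeffB !mcoeffX !eqxx [v == u]eq_sym (negPf uv).
by rewrite subr0 sub0r oppr_eq0 oner_eq0.
Qed.

Lemma min_seq (T : eqType) (le : rel T) (s : seq T) :
  total le -> transitive le -> s != [::] ->
  exists2 x, x \in s & forall y, y \in s -> le x y.
Proof.
move=> tot tr; elim: s => // x s IHs _.
have lexx y : le y y by have:= tot y y; rewrite orbb.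
case: (s =P [::]) => [->|/eqP/IHs[y ys ymin]].
  by exists x => [|y]; rewrite inE ?eqxx // => /eqP->.
case/orP: (tot x y) => xy; [exists x | exists y] => //.
- by rewrite inE eqxx.
- by move=> z; rewrite inE => /orP[/eqP->//|/ymin]; apply: tr.
- by rewrite inE ys orbT.
- by move=> z; rewrite inE => /orP[/eqP->//|/ymin].
Qed.

(** * Standard monomials and reduced Groebner bases *)

Section TermOrder.

Variable le : rel 'X_{1..q}.
Hypothesis le_order : term_order le.

Let le_total : total le. Proof. by case: le_order. Qed.
Let le_anti m u : le m u -> le u m -> m = u.
Proof. by case: le_order => _ anti _ _ _ mu um; apply: anti; rewrite mu um. Qed.
Let le_trans : transitive le. Proof. by case: le_order. Qed.
Let le_add m u v : le u v -> le (u + m)%MM (v + m)%MM.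
Proof. by case: le_order => _ _ _ _; apply. Qed.

Lemma lem_le u v : (u <= v)%MM -> le u v.
Proof.
case: le_order => _ _ _ le0 _ uv.
by rewrite -(submK uv) -[X in le X _]add0m; apply: le_add.
Qed.

(** The standard monomials are the smallest ones of their fibers. By [mdeg_le_adeg] the degree bound
    excludes nothing from the fiber; it makes the quantifier finite and the property boolean. *)
Definition standard m : bool :=
  [forall m' : 'X_{1..q < (mdeg (adeg m)).+1}, (adeg m' == adeg m) ==> le m m'].

Lemma standardP m : reflect (forall m', adeg m' = adeg m -> le m m') (standard m).
Proof.
apply: (iffP forallP) => [std m' E|std m']; last by apply/implyP => /eqP; apply: std.
have lt : (mdeg m' < (mdeg (adeg m)).+1)%N by rewrite ltnS -E mdeg_le_adeg.
by have:= std (BMultinom lt); rewrite /= E eqxx.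
Qed.

Lemma nonstandardP m : reflect (exists m', [/\ adeg m' = adeg m, m' != m & le m' m])
  (~~ standard m).
Proof.
apply: (iffP idP) => [/standardP nstd|[m' [E ne m'm]]]; last first.
  by apply/standardP => /(_ _ E) mm'; rewrite (le_anti m'm mm') eqxx in ne.
apply: NNPP => no; apply: nstd => m' E; have [->|ne] := eqVneq m' m.
  by have:= le_total m m; rewrite orbb.
by case/orP: (le_total m m') => // m'm; case: no; exists m'.
Qed.

(** A monomial below [u] in its fiber, multiplied by the quotient of [v] by [u], gives one below [v]
    in the fiber of [v]. *)
Lemma standard_le u v : (u <= v)%MM -> standard v -> standard u.
Proof.
move=> uv; apply: contraTT => /nonstandardP[m [E ne mu]]; apply/nonstandardP.
exists (m + (v - u))%MM; split.
- by rewrite adegD E -adegD addmC submK.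
- by apply: contra ne => /eqP E'; apply/eqP/(@addIm _ (v - u)%MM); rewrite E' addmC submK.
- by rewrite -{2}(submK uv) [X in le _ X]addmC; apply: le_add.
Qed.

Lemma standard_exists m : exists m', (adeg m' == adeg m) && standard m'.
Proof.
pose s0 : seq 'X_{1..q} := [seq val m' | m' : 'X_{1..q < (mdeg (adeg m)).+1}].
pose s := [seq m' <- s0 | adeg m' == adeg m].
have sP m' : adeg m' = adeg m -> m' \in s.
  move=> E; have lt : (mdeg m' < (mdeg (adeg m)).+1)%N by rewrite ltnS -E mdeg_le_adeg.
  by rewrite mem_filter E eqxx; apply/mapP; exists (BMultinom lt); rewrite ?mem_enum.
have s_neq0 : s != [::] by apply/eqP => sE; have := sP m erefl; rewrite sE.
have [x xs xmin] := min_seq le_total le_trans s_neq0.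
have /eqP E : adeg x == adeg m.
  by move: xs; rewrite mem_filter => /andP[].
exists x; rewrite E eqxx; apply/standardP => m' E'; apply/xmin/sP.
by rewrite E'.
Qed.

Lemma lead_nonstandard f m : toric f -> lead_monom le f m -> ~~ standard m.
Proof.
move=> fI [mf mmax]; have [m' [m'f ne E]] := toric_mate fI mf.
by apply/nonstandardP; exists m'; split=> //; apply: mmax.
Qed.

Lemma lead_unique f m m' : lead_monom le f m -> lead_monom le f m' -> m = m'.
Proof. by move=> [mf mmax] [m'f m'max]; apply: le_anti; auto. Qed.

Lemma lead_binomial u v : u != v -> le v u -> lead_monom le ('X_[u] - 'X_[v] : S) u.
Proof.
move=> uv vu; have /andP[uS _] := mem_msupp_binomial uv; split=> // m.
by case/msupp_binomial => ->//; have:= le_total u u; rewrite orbb.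
Qed.

Lemma lead_exists f : f != 0 -> exists m, lead_monom le f m.
Proof.
rewrite -msupp_eq0 => nz.
have ge_total : total (fun u v => le v u) by move=> u v; apply: le_total.
have ge_trans : transitive (fun u v => le v u) by move=> u v w vu uw; apply: le_trans uw vu.
by have [m mf mmax] := min_seq ge_total ge_trans nz; exists m; split.
Qed.

Definition min_nonstandard m : Prop :=
  ~~ standard m /\ forall m', (m' <= m)%MM -> ~~ standard m' -> m' = m.

(* The reduced Groebner basis consists of the binomials [X_m - X_(nf m)], for [m]
   a minimal nonstandard monomial and [nf m] the smallest monomial of its fiber. *)
Lemma reduced_groebner_exists : exists G, reduced_groebner_basis le toric G /\
  forall u v, min_nonstandard u -> standard v -> adeg u = adeg v ->
    ('X_[u] - 'X_[v] : S) \in G.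
Proof.
have [s [sP Ps]] := dickson (fun m => ~~ standard m).
pose nf m := sval (sigW (standard_exists m)).
have nfE m : adeg (nf m) = adeg m by rewrite /nf; case: sigW => /= ? /andP[/eqP].
have nfS m : standard (nf m) by rewrite /nf; case: sigW => /= ? /andP[].
have nf_uniq u v : standard v -> adeg u = adeg v -> nf u = v.
  move=> /standardP vS E; have /standardP uS := nfS u.
  by apply: le_anti; [apply: uS|apply: vS]; rewrite nfE.
have nf_neq m : ~~ standard m -> m != nf m by apply: contraNneq => ->.
have nf_le m : le (nf m) m by have /standardP := nfS m; apply; rewrite nfE.
pose minl m := all (fun m' => (m' <= m)%MM ==> (m' == m)) s.
pose G := [seq 'X_[m] - 'X_[nf m] : S | m <- s & minl m].
have minP m : m \in s -> minl m -> min_nonstandard m.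
  move=> ms /allP mmin; split=> [|m' le1 /Ps[m2 m2s le2]]; first exact: sP.
  have /eqP m2m : m2 == m by apply: (implyP (mmin _ m2s)); apply: lepm_trans le2 le1.
  by apply/mnmP => i; apply/eqP; rewrite eqn_leq -{2}m2m; apply/andP; split; apply/mnm_lepP.
have Pmin m : min_nonstandard m -> (m \in s) /\ minl m.
  move=> [mS mmin]; have [m' m's le1] := Ps _ mS.
  split; first by rewrite -(mmin m') // sP.
  by apply/allP => k ks; apply/implyP => km; apply/eqP/mmin => //; apply: sP.
have GP g : g \in G -> exists2 m, min_nonstandard m & g = 'X_[m] - 'X_[nf m].
  by move=> /mapP[m]; rewrite mem_filter => /andP[mm ms] ->; exists m => //; apply: minP.
have PG m : min_nonstandard m -> ('X_[m] - 'X_[nf m] : S) \in G.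
  by move=> /Pmin[ms mm]; apply/mapP; exists m; rewrite // mem_filter mm ms.
have leadG m : min_nonstandard m -> lead_monom le ('X_[m] - 'X_[nf m] : S) m.
  by move=> [mS _]; apply: lead_binomial => //; apply: nf_neq.
have GI g : g \in G -> toric g by move/GP => [m _ ->]; apply/toricX.
exists G; split; last by move=> u v uS vS E; rewrite -(nf_uniq u v) //; apply: PG.
split; [split=> // h; split|move=> g /GP[m mS ->]; split].
- apply: ideal_gen_le => _ [g [m [gG gm ->]]]; apply: ideal_gen_mem.
  by exists g, m; split=> //; apply: GI.
- apply: ideal_gen_le => _ [g [m [gI gm ->]]].
  have [m' m's le1] := Ps _ (lead_nonstandard gI gm).
  have [k [km kS]] : exists k, (k <= m)%MM /\ min_nonstandard k.
    have [d] := ubnP (mdeg m'); elim: d m' {m's} le1 (sP _ m's) => // d IHd m' le1 m'S lt.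
    have [|nmin] := classic (min_nonstandard m'); first by exists m'.
    have [k [le2 kS ne]] : exists k, [/\ (k <= m')%MM, ~~ standard k & k != m'].
      apply: NNPP => no; apply: nmin; split=> // k le2 kS.
      by apply: NNPP => /eqP ne; apply: no; exists k.
    apply: (IHd k) => //; first exact: lepm_trans le2 le1.
    suff : (mdeg (m' - k) != 0)%N by move: lt; rewrite -{1}(submK le2) mdegD; lia.
    by apply: contra ne; rewrite mdeg_eq0 => /eqP E; rewrite -(submK le2) E add0m.
  rewrite -(submK km) mpolyXD; apply/ideal_genM/ideal_gen_mem.
  by exists ('X_[k] - 'X_[nf k]), k; split=> //; [apply: PG | apply: leadG].
- exists m; split; first exact: leadG.
  have /nf_neq ne := proj1 mS.
  by rewrite mcoeffB !mcoeffX eqxx eq_sym (negPf ne) subr0.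
- move=> _ m' k /GP[m2 m2S ->] ne /(lead_unique (leadG _ m2S)) <- km.
  apply/negP => le2; case: (msupp_binomial km) le2 => -> le2.
    by move: ne; rewrite (proj2 mS m2 le2 (proj1 m2S)) eqxx.
  by case/negP: (proj1 m2S); apply: standard_le le2 (nfS m).
Qed.

Lemma groebner_lead G f m : groebner_basis le toric G -> toric f -> lead_monom le f m ->
  exists g m', [/\ g \in G, lead_monom le g m' & (m' <= m)%MM].
Proof.
move=> [_ GI] fI fm; have /GI : initial_ideal le toric 'X_[m].
  by apply: ideal_gen_mem; exists f, m.
case/(mem_monomial_ideal (P := fun m' => exists2 g, g \in G & lead_monom le g m')).
  by move=> _ [g [m' [gG gm' ->]]]; exists m' => //; exists g.
by move=> m' [g gG gm'] le1; exists g, m'.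
Qed.

(** Reducedness leaves in [g] only its leading monomial and one mate in the same fiber. A binomial
    dividing [g] then has the leading monomial of [g] as its own, which determines its other
    term. *)
Lemma reduced_groebner_graver G g :
  reduced_groebner_basis le toric G -> g \in G -> graver toric g.
Proof.
move=> [GB red] gG; have [[m [gm g1]] gred] := red g gG.
have gI : toric g by case: GB => GI _; apply: GI.
(* Among the monomials of [g], only [m] can be divisible by the leading monomial of an element of
   the ideal. *)
have redm f k : toric f -> lead_monom le f k -> forall k', k' \in msupp g ->
    (k <= k')%MM -> k' = m.
  move=> fI fk k' k'g kk'; have [g' [m' [g'G g'm' m'k]]] := groebner_lead GB fI fk.
  have m'k' := lepm_trans m'k kk'.
  have [gg'|/gred ne] := eqVneq g' g; last by case/negP: (ne m' k' g'G g'm' k'g).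
  rewrite gg' in g'm'; rewrite -(lead_unique gm g'm') in m'k'.
  by apply: le_anti; [apply: (proj2 gm) | apply: lem_le].
have [m' [m'g ne E]] := toric_mate gI (proj1 gm).
have bI : toric ('X_[m] - 'X_[m'] : S) by apply/toricX.
(* A nonzero difference would have a leading monomial belonging to [g] and different from [m],
   against [redm]. *)
have gE : g = 'X_[m] - 'X_[m'].
  apply/eqP; rewrite -subr_eq0; apply/negPn/negP => /lead_exists[k hk].
  have hI := toricB gI bI; have [k0 _] := hk.
  have km : k != m.
    apply: contraTneq k0 => ->; rewrite mcoeff_msupp !mcoeffB !mcoeffX eqxx.
    by rewrite (negPf ne) g1 subr0 subrr eqxx.
  have kg : k \in msupp g.
    have [->//|km'] := eqVneq k m'; move: k0.
    rewrite !mcoeff_msupp !mcoeffB !mcoeffX [m == k]eq_sym [m' == k]eq_sym.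
    by rewrite (negPf km) (negPf km') !subr0.
  by move/eqP: km; apply; apply: redm hI hk _ kg (lepm_refl k).
apply/graverP; exists m, m'; split=> //; split=> //; first by rewrite eq_sym.
move=> u v uv Euv um vm'; have uvI : toric ('X_[u] - 'X_[v] : S) by apply/toricX.
(* If [u] leads, it is divisible by a leading monomial of [G], which must be [m]; then [v] divides
   [m'] within the same fiber. If [v] leads, [redm] identifies [m'] with [m]. *)
case/orP: (le_total v u) => [vu|uv'].
  have um' : u = m.
    have [g' [k [g'G g'k ku]]] := groebner_lead GB uvI (lead_binomial uv vu).
    have km := lepm_trans ku um.
    have [gg'|/gred ne'] := eqVneq g' g; last by case/negP: (ne' k m g'G g'k (proj1 gm)).
    rewrite gg' in g'k; rewrite -(lead_unique gm g'k) in ku.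
    by apply/mnmP => i; apply/eqP; rewrite eqn_leq; apply/andP; split; apply/mnm_lepP.
  by split=> //; apply: le_adeg_eq => //; rewrite -Euv um' E.
have vuI : toric ('X_[v] - 'X_[u] : S) by apply/toricX.
have vu : v != u by rewrite eq_sym.
have m'm := redm _ _ vuI (lead_binomial vu uv') m' m'g vm'.
by rewrite m'm eqxx in ne.
Qed.

End TermOrder.

Lemma universal_groebner_graver f : universal_groebner toric f -> graver toric f.
Proof.
move=> [le [G [leo red]]] [fG|fG]; first exact: reduced_groebner_graver red fG.
by rewrite -[f]opprK; apply/graver_sign/(reduced_groebner_graver leo red fG).
Qed.

Lemma universal_groebner_sign : sign_closed (universal_groebner toric).
Proof.
by move=> f [le [G [leo red fG]]]; exists le, G; rewrite opprK; split=> //; case: fG; auto.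
Qed.

Lemma primitive_coprime u v c : primitive u v -> (c <= u)%MM -> (c <= v)%MM -> c = 0%MM.
Proof.
move=> [uv E min] cu cv; have [||||Eu _] := min (u - c)%MM (v - c)%MM.
- by apply: contra uv => /eqP E'; rewrite -(submK cu) E' submK.
- by apply/(@addIm _ (adeg c)); rewrite -!adegD !submK.
- exact: lem_subr.
- exact: lem_subr.
by apply/(@addmI _ (u - c)%MM); rewrite submK // addm0.
Qed.

(** Subtraction of exponents is truncated, so [u - w] and [w - u] are what is left after cancelling
    the common factor of [u] and [w]. They divide [u] and [v], and primitivity applies to them. *)
Lemma primitive_le_add u v w : primitive u v -> adeg w = adeg u -> (w <= u + v)%MM ->
  w = u \/ w = v.
Proof.
move=> [_ _ min] Ew /mnm_lepP wuv; have [->|wu] := eqVneq w u; [by left|right].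
have [||||Eu <-] := min (u - w)%MM (w - u)%MM.
- apply: contra wu => /eqP/mnmP E; apply/eqP/mnmP => i.
  by have := E i; rewrite !mnmBE; lia.
- apply/(@addmI _ (adeg u)); rewrite -{1}Ew -!adegD.
  by congr adeg; apply/mnmP => i; rewrite !mnmDE !mnmBE; lia.
- exact: lem_subr.
- by apply/mnm_lepP => i; have := wuv i; rewrite mnmDE mnmBE; lia.
apply/mnmP => i; move/mnmP/(_ i): Eu; rewrite !mnmBE.
by have [->|] := posnP (u i); [rewrite subn0 | lia].
Qed.

(* For an order in which the variables off the supports of [u] and [v] are the
   largest, no monomial of the fiber other than [u] and [v] matters. *)
Lemma circuit_universal_groebner u v :
    u != v -> adeg u = adeg v ->
    (forall c, (c <= u)%MM -> (c <= v)%MM -> c = 0%MM) ->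
    (forall w, adeg w = adeg u -> (forall e, w e != 0%N -> (u e != 0%N) || (v e != 0%N)) ->
       w = u \/ w = v) ->
  universal_groebner toric ('X_[u] - 'X_[v]).
Proof.
pose b u v := fun e : 'I_q => (u e == 0%N) && (v e == 0%N).
(* It suffices to treat the case in which [u'] is the larger monomial. The other case follows by a
   change of sign, as the order depends only on the union of the supports. *)
have main u' v' : u' != v' -> adeg u' = adeg v' ->
    (forall c, (c <= u')%MM -> (c <= v')%MM -> c = 0%MM) ->
    (forall w, adeg w = adeg u' ->
       (forall e, w e != 0%N -> (u' e != 0%N) || (v' e != 0%N)) -> w = u' \/ w = v') ->
    block_le (b u' v') v' u' -> universal_groebner toric ('X_[u'] - 'X_[v']).
  move=> {u v} ne E cop circ; rename u' into u; rename v' into v.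
  set le := block_le _ => vu; have leo : term_order le := block_le_term_order _.
  have [tot anti _ _ lead] := leo.
  have mask0 w : w = u \/ w = v -> mmask (b u v) w = 0%MM.
    by case=> ->; apply/mnmP => e; rewrite mnmE mnm0E /b; case: ifP => // /andP[/eqP ? /eqP ?].
  have le_circ k w : k = u \/ k = v -> adeg w = adeg u -> le w k -> w = u \/ w = v.
    move=> /mask0 k0 Ew wk; apply: circ => // e we; apply: contraNT we => be.
    have {be} be : b u v e by rewrite negb_or !negbK in be.
    have /mnmP/(_ e) : mmask (b u v) w = 0%MM.
      case/orP: wk; rewrite k0; last by case/andP => /eqP.
      by rewrite ltNge le0m.
    by rewrite mnmE be mnm0E => ->.
  have lexx k : le k k by have:= tot k k; rewrite orbb.
  have [G [red memG]] := reduced_groebner_exists leo.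
  exists le, G; split=> //; left; apply: memG => //.
    have uS : ~~ standard le u by apply/(nonstandardP leo); exists v; rewrite E eq_sym.
    split=> // m mu /(nonstandardP leo)[k [Ek km le_km]].
    have wE : adeg (k + (u - m))%MM = adeg u by rewrite adegD Ek -adegD addmC submK.
    have [||w_u|w_v] := le_circ u _ _ wE; first by left.
    - by rewrite -{2}(submK mu) [(u - m + m)%MM]addmC; apply: lead.
    - case/eqP: km; apply/(@addIm _ (u - m)%MM).
      by rewrite w_u addmC submK.
    - have : (u - m = 0)%MM by apply: cop; [apply: lem_subr | rewrite -w_v lem_addl].
      by move=> um; rewrite -(submK mu) um add0m.
  apply/standardP => w Ew; case/orP: (tot v w) => // wv.
  by have [||->|->] := le_circ v w _ _ wv; rewrite ?Ew ?E //; right.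
move=> ne E cop circ; have [tot _ _ _ _] := block_le_term_order (b u v).
case/orP: (tot v u) => vu; first exact: main.
rewrite -opprB; apply: universal_groebner_sign; apply: main.
- by rewrite eq_sym.
- by [].
- by move=> c cv cu; apply: cop.
- move=> w Ew supp; case: (circ w) => [||->|->]; rewrite ?Ew ?E; auto.
  by move=> e /supp; rewrite orbC.
- have maskC m : mmask (b v u) m = mmask (b u v) m.
    by apply/mnmP => e; rewrite !mnmE /b andbC.
  by rewrite /block_le !maskC.
Qed.

Definition binomial_fibers : Prop :=
  forall u v w, primitive u v -> adeg w = adeg u -> w = u \/ w = v.

(** If a multiple of a generator contains the monomial [u], its other monomial is in the fiber,
    hence is [v], and coprimality of [u] and [v] makes the multiplier trivial. Without such a
    generator, restriction to [u] would kill the binomial. *)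
Lemma indispensable G u v :
    sign_closed G -> (forall g, G g -> is_binomial g) -> generates G toric ->
    primitive u v -> (forall w, adeg w = adeg u -> w = u \/ w = v) ->
  G ('X_[u] - 'X_[v]).
Proof.
move=> Gs Gb GI uv fib; have [ne E _] := uv; apply: NNPP => nG.
have GIs g : G g -> toric g by move=> Gg; apply/GI/ideal_gen_mem.
have noT g c m : G g -> m \in msupp g -> (c + m == u)%MM = false.
  have noT' a b : a != b -> G ('X_[a] - 'X_[b]) -> (c + a)%MM <> u.
    move=> ab Gab ca; have /toricX Eab := GIs _ Gab.
    have [|cb|cb] := fib (c + b)%MM; first by rewrite adegD -Eab -adegD ca.
      by case/eqP: ab; apply/(@addmI _ c); rewrite ca cb.
    have c0 : c = 0%MM.
      by apply: (primitive_coprime uv); rewrite -?ca -?cb lem_addr.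
    by apply: nG; rewrite -ca -cb c0 !add0m.
  move=> Gg mg; apply/eqP; case: (Gb g Gg) => a [b [ab gE]].
  rewrite gE in Gg mg; case: (msupp_binomial mg) => ->; first exact: noT' Gg.
  by apply: (noT' b a); rewrite 1?eq_sym // -opprB; apply: Gs.
have /(ideal_gen_restr (T := pred1 u)) : ideal_gen G ('X_[u] - 'X_[v]) by apply/GI/toricX.
case=> [g c m m' Gg mg m'g|s [sG Es]]; first by rewrite /= !(noT g).
case: s sG Es => [|t s] sG.
  move/mpolyP/(_ u); rewrite big_nil mcoeff_restr mcoeff0 mcoeffB !mcoeffX /= eqxx.
  by rewrite eq_sym (negPf ne) subr0 => /eqP; rewrite oner_eq0.
case: (sG t); first by rewrite inE eqxx.
by move=> Gt [c [m [mt /=]]]; rewrite (noT t.2).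
Qed.

Lemma graver_binomial f : graver toric f -> is_binomial f.
Proof. by move=> [u [v [uv -> _ _]]]; exists u, v. Qed.

Lemma min_gen_set_ext (G G' I : S -> Prop) :
  (forall f, G f <-> G' f) -> min_gen_set G I -> min_gen_set G' I.
Proof.
move=> GG' [Gs GI Gm]; split=> [f /GG'/Gs/GG'//|f|H Hs HG HI f /GG'].
  by rewrite -GI; split; apply: ideal_gen_le => g /GG'; apply: ideal_gen_mem.
by apply: Gm => // g /HG/GG'.
Qed.

(** * Consequences of two-element fibers *)

Section BinomialFibers.

Hypothesis fibers2 : binomial_fibers.

Lemma binomial_fibers_graver G f :
    sign_closed G -> (forall g, G g -> is_binomial g) -> generates G toric ->
  graver toric f -> G f.
Proof.
move=> Gs Gb GI /graverP[u [v [uv ->]]]; apply: indispensable => // w.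
exact: fibers2.
Qed.

Lemma binomial_fibers_strongly_robust : min_gen_set (graver toric) toric.
Proof.
split=> [||G Gs GGr GI f]; [exact: graver_sign | exact: graver_generates |].
by apply: binomial_fibers_graver => // g /GGr/graver_binomial.
Qed.

Lemma binomial_fibers_groebner f : universal_groebner toric f <-> graver toric f.
Proof.
split; first exact: universal_groebner_graver.
move/graverP=> [u [v [uv ->]]]; have [ne E _] := uv.
apply: circuit_universal_groebner => // [c|w Ew _]; first exact: primitive_coprime.
exact: fibers2.
Qed.

Lemma binomial_fibers_markov f : universal_markov toric f <-> graver toric f.
Proof.
split=> [[G [Gb [Gs GI Gm] Gf]]|fG]; last first.
  exists (graver toric); split=> //; first exact: graver_binomial.
  exact: binomial_fibers_strongly_robust.
apply: Gm Gf; [exact: graver_sign | | exact: graver_generates].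
by move=> g; apply: binomial_fibers_graver.
Qed.

Lemma binomial_fibers_robust : min_gen_set (universal_groebner toric) toric.
Proof.
apply: min_gen_set_ext binomial_fibers_strongly_robust => f.
by rewrite binomial_fibers_groebner.
Qed.

Lemma binomial_fibers_generalized_robust f :
  universal_groebner toric f <-> universal_markov toric f.
Proof. by rewrite binomial_fibers_groebner binomial_fibers_markov. Qed.

Lemma binomial_fibers_weakly_robust f : graver toric f <-> universal_markov toric f.
Proof. by rewrite binomial_fibers_markov. Qed.

End BinomialFibers.

(* The binomial is a combination of binomials of [I] of smaller degree, multiplied
   by the variables [e1] and [e2]. *)
Lemma not_minimal_generator G u v w e1 e2 :
    (forall g, G g -> is_binomial g) -> min_gen_set G toric ->
    u != v -> adeg u = adeg v -> adeg w = adeg u ->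
    u e1 != 0%N -> w e1 != 0%N -> v e2 != 0%N -> w e2 != 0%N ->
  ~ G ('X_[u] - 'X_[v]).
Proof.
move=> Gb [Gs GI Gm] uv E Ew ue1 we1 ve2 we2; set f := _ - _ => Gf.
(* [G'] drops the binomial and its negative; once it is seen to generate, minimality puts [f] back
   into it, which is absurd. *)
pose G' g := [/\ G g, g != f & g != - f].
suff : G' f by case=> _; rewrite eqxx.
have GIs g : G g -> toric g by move=> Gg; apply/GI/ideal_gen_mem.
(* A generator contributing to the fiber of [a] has degree dividing that of [a], which is strictly
   below the degree of [u], so it is neither [f] nor [- f]. *)
have lower a b d : d != 0%MM -> adeg a = adeg b -> (adeg d + adeg a)%MM = adeg u ->
    ideal_gen G' ('X_[a] - 'X_[b]).
  move=> d0 Eab Ed; pose T := [pred m | adeg m == adeg a].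
  have /(ideal_gen_restr (T := T)) : ideal_gen G ('X_[a] - 'X_[b]) by apply/GI/toricX.
  rewrite restr_id => [|m /msupp_binomial[]->]; rewrite ?inE ?Eab ?eqxx //.
  move=> H; apply: ideal_gen_le (H _) => {H}.
    move=> g [Gg [c [m [mg /eqP Ecm]]]]; apply: ideal_gen_mem.
    have gf : ~ (g = f \/ g = - f).
      move=> gE; case/negP: d0.
      have Em : adeg m = adeg u by case: gE mg => ->; rewrite ?opprB => /msupp_binomial[]->.
      have /eqP : (adeg d + adeg c + adeg u = 0 + adeg u)%MM.
        by rewrite -Em -addmA -adegD Ecm Ed Em add0m.
      by rewrite eqm_add2r mnmD_eq0 adeg_eq0 => /andP[].
    by split=> //; apply/eqP => gE; apply: gf; [left | right].
  move=> g c m m' /[dup] Gg /Gb [x [y [_ gE]]]; move: (GIs _ Gg); rewrite gE => /toricX Exy.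
  move=> /msupp_binomial mE /msupp_binomial m'E; rewrite /= !adegD.
  by case: mE => ->; case: m'E => ->; rewrite ?Exy.
have f_gen : ideal_gen G' f.
  have U1u : (U_(e1) <= u)%MM by rewrite lep1mP.
  have U1w : (U_(e1) <= w)%MM by rewrite lep1mP.
  have U2v : (U_(e2) <= v)%MM by rewrite lep1mP.
  have U2w : (U_(e2) <= w)%MM by rewrite lep1mP.
  have -> : f = 'X_e1 * ('X_[u - U_(e1)] - 'X_[w - U_(e1)]) +
                'X_e2 * ('X_[w - U_(e2)] - 'X_[v - U_(e2)]).
    rewrite !mulrBr -!mpolyXD ![(U_(_) + _)%MM]addmC !submK // /f; ring.
  have EB m m' c : (c <= m)%MM -> (c <= m')%MM -> adeg m = adeg m' ->
      adeg (m - c)%MM = adeg (m' - c)%MM.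
    by move=> le1 le2 Emm'; apply/(@addIm _ (adeg c)); rewrite -!adegD !submK.
  apply: ideal_genD; apply: ideal_genM.
    apply: (lower _ _ U_(e1)%MM); rewrite ?mnm1_eq0 //; first by apply: EB.
    by rewrite -adegD addmC submK.
  apply: (lower _ _ U_(e2)%MM); rewrite ?mnm1_eq0 //; first by apply: EB; rewrite // Ew.
  by rewrite -adegD addmC submK.
apply: Gm (Gf) => [g [Gg gf gNf]|g []//|g].
  by split; [apply: Gs | rewrite eqr_oppLR | rewrite eqr_opp].
split; first by apply: toric_gen => h [/GIs].
move/GI; apply: ideal_gen_le => h Gh.
have [->//|hf] := eqVneq h f; have [->|hNf] := eqVneq h (- f).
  exact: ideal_genN.
by apply: ideal_gen_mem.
Qed.

Lemma bad_circuit u v w e1 e2 :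
    u != v -> adeg u = adeg v ->
    (forall c, (c <= u)%MM -> (c <= v)%MM -> c = 0%MM) ->
    (forall w, adeg w = adeg u -> (forall e, w e != 0%N -> (u e != 0%N) || (v e != 0%N)) ->
       w = u \/ w = v) ->
    adeg w = adeg u -> u e1 != 0%N -> w e1 != 0%N -> v e2 != 0%N -> w e2 != 0%N ->
  [/\ ~ min_gen_set (graver toric) toric,
      ~ min_gen_set (universal_groebner toric) toric,
      ~ (forall f, universal_groebner toric f <-> universal_markov toric f) &
      ~ (forall f, graver toric f <-> universal_markov toric f)].
Proof.
move=> uv E cop circ Ew ue1 we1 ve2 we2.
have fU := circuit_universal_groebner uv E cop circ.
have fG := universal_groebner_graver fU.
have nG G : (forall g, G g -> is_binomial g) -> min_gen_set G toric ->
    ~ G ('X_[u] - 'X_[v]).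
  by move=> Gb Gm; apply: not_minimal_generator uv E Ew ue1 we1 ve2 we2.
have nM : ~ universal_markov toric ('X_[u] - 'X_[v]).
  by move=> [G [Gb Gm]]; apply: nG.
split.
- by move=> H; case: (nG _ graver_binomial H).
- by move=> H; case: (nG _ _ H) => // g /universal_groebner_graver/graver_binomial.
- by move=> H; apply/nM/H.
- by move=> H; apply/nM/H.
Qed.

End Toric.

(** * Paths and cycles as vertex sequences *)

Section ConsecutivePairs.

Variable T : finType.
Implicit Types (x y z : T) (p q s : seq T) (X : {set T}).

Definition consec s : {set {set T}} := [set [set u.1; u.2] | u in zip s (behead s)].

Lemma consec0 : consec [::] = set0.
Proof. by apply/setP => X; rewrite inE; apply/imsetP => -[]. Qed.

Lemma consec1 x : consec [:: x] = set0.
Proof. by apply/setP => X; rewrite inE; apply/imsetP => -[]. Qed.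

Lemma consec_cons x y p : consec [:: x, y & p] = [set x; y] |: consec (y :: p).
Proof.
apply/setP => X; rewrite !inE; apply/imsetP/orP => [[u /=]|].
  by rewrite inE => /orP[/eqP->|up] ->; [left|right; apply/imsetP; exists u].
case=> [/eqP->|/imsetP[u up ->]]; first by exists (x, y); rewrite //= inE eqxx.
by exists u; rewrite //= inE up orbT.
Qed.

Lemma consec_cat p x q : consec (p ++ x :: q) = consec (rcons p x) :|: consec (x :: q).
Proof.
elim: p => [|y p IHp] /=; first by rewrite consec1 set0U.
case: p IHp => [|z p] IHp; first by rewrite /= !consec_cons consec1 setU0.
by rewrite /= !consec_cons -setUA -IHp.
Qed.

Lemma consec_rev s : consec (rev s) = consec s.
Proof.
elim: s => // x [|y s] // IHs.
rewrite consec_cons -IHs !rev_cons -!cats1 -catA /= consec_cat cats1.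
by rewrite consec_cons consec1 setU0 setUC [[set y; x]]setUC.
Qed.

Lemma consecP x0 s X :
  reflect (exists2 i, (i.+1 < size s)%N & X = [set nth x0 s i; nth x0 s i.+1]) (X \in consec s).
Proof.
elim: s => [|x [|y s] IHs]; first by rewrite consec0 inE; constructor=> -[].
  by rewrite consec1 inE; constructor=> -[].
rewrite consec_cons !inE; apply: (iffP orP) => [[/eqP->|/IHs[i lt E]]|[[|i] lt E]].
- by exists 0%N.
- by exists i.+1.
- by left; rewrite E.
- by right; apply/IHs; exists i.
Qed.

Lemma consec_sub s X : X \in consec s -> X \subset s.
Proof.
case: s => [|x0 s]; first by rewrite consec0 inE.
case/(consecP x0) => i lt ->; apply/subsetP => x; rewrite !inE.
by case/orP => /eqP->; rewrite -in_cons mem_nth // ltnW.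
Qed.

Lemma consec_mem x s : x \in s -> (1 < size s)%N -> exists2 X, X \in consec s & x \in X.
Proof.
move=> xs lt; rewrite -(nth_index x xs); move: xs; rewrite -index_mem.
set i := index x s => ilt; have [lt'|le] := ltnP i.+1 (size s).
  by exists [set nth x s i; nth x s i.+1]; [apply/(consecP x); exists i | rewrite !inE eqxx].
have i0 : (0 < i)%N by lia.
exists [set nth x s i.-1; nth x s i]; last by rewrite !inE eqxx orbT.
by apply/(consecP x); exists i.-1; rewrite prednK.
Qed.

(** Used to see that the closing edge of a cycle is not on the remaining path, and that a strand
    containing an edge from [a] to [b] is this edge alone. *)
Lemma consec_ends x s : uniq (x :: s) -> [set x; last x s] \in consec (x :: s) ->
  (size s <= 1)%N.
Proof.
move=> us /(consecP x)[[|i] lt /setP E]; last first.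
  have := E x; rewrite !inE eqxx /= => /esym/orP[]/eqP xs; case/andP: us => /negP[];
  by rewrite xs mem_nth //; move: lt => /=; lia.
have := E (last x s); rewrite !inE eqxx orbT /= => /esym/orP[]/eqP ls.
  by case: s us ls {lt E} => //= y s /andP[/negP xs _] ls; case: xs; rewrite -ls mem_last.
case: s us ls {lt E} => //= y [|z s] //= /and3P[_ /negP ys _] ls.
by case: ys; rewrite -ls mem_last.
Qed.

Lemma cycle_consec x s : uniq (x :: s) ->
  [set [set y; next (x :: s) y] | y in x :: s] = consec (x :: rcons s x).
Proof.
move=> us; apply/setP => X; apply/imsetP/(consecP x) => [[y ys ->]|[i lt ->]].
  exists (index y (x :: s)).
    by rewrite -rcons_cons size_rcons ltnS index_mem.
  rewrite -rcons_cons nth_rcons index_mem ys nth_index // next_nth ys; congr [set _; _].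
  rewrite /= nth_rcons; case: ltnP => // le; rewrite nth_default // if_same.
  by [].
rewrite -rcons_cons size_rcons ltnS in lt; exists (nth x (x :: s) i).
  by rewrite mem_nth.
rewrite next_nth mem_nth // index_uniq // -rcons_cons nth_rcons lt; congr [set _; _].
by rewrite /= nth_rcons; case: ltnP => // le; rewrite nth_default // if_same.
Qed.

Lemma cycle_consec_rot s x : uniq s -> x \in s ->
  exists2 p, perm_eq (x :: p) s & forall y, next (x :: p) y = next s y.
Proof.
move=> us /rot_to[i p E]; exists p; first by rewrite -E perm_rot.
by move=> y; rewrite -E next_rot.
Qed.

End ConsecutivePairs.

(** * Slopes and signs *)

Lemma slope_signs (T : finType) (e1 r1 : T) (sigma tau tau' : T -> rat) (c : rat) :
    e1 != r1 -> c != sigma e1 ->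
    (forall i, i != e1 -> i != r1 -> sigma i = c) ->
    \sum_i tau i = 0 -> \sum_i tau i * sigma i = 0 ->
    \sum_i tau' i = 0 -> \sum_i tau' i * sigma i = 0 ->
    0 <= tau r1 * tau' r1 ->
  0 <= tau e1 * tau' e1.
Proof.
move=> er ce sE.
(* Subtracting [c] times the first relation from the second leaves only the terms of [e1] and [r1].
   So the entry at [e1] is the same multiple of the entry at [r1] for both vectors, and the products
   of entries differ by a square factor. *)
have main (t : T -> rat) : \sum_i t i = 0 -> \sum_i t i * sigma i = 0 ->
    t e1 = - ((sigma r1 - c) / (sigma e1 - c)) * t r1.
  move=> t0 ts; have : \sum_i t i * (sigma i - c) = 0.
    under eq_bigr do rewrite mulrBr.
    by rewrite sumrB ts -mulr_suml t0 mul0r subr0.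
  rewrite (bigD1 e1) //= (bigD1 r1) 1?eq_sym //= big1 => [|i /andP[ie ir]]; last first.
    by rewrite sE // subrr mulr0.
  rewrite addr0 => E1; have d0 : sigma e1 - c != 0 by rewrite subr_eq0 eq_sym.
  apply: (mulIf d0); rewrite mulrAC mulNr divfK //.
  by move: E1; rewrite mulNr [t r1 * _]mulrC => /eqP; rewrite addr_eq0 => /eqP.
move=> t0 ts t0' ts' le; rewrite (main tau) // (main tau') //.
by rewrite mulrACA mulr_ge0 // mulrNN -expr2 sqr_ge0.
Qed.

Lemma card_le2 (T : finType) (A : {set T}) i j k : (#|A| <= 2)%N ->
  i \in A -> j \in A -> k \in A -> i != j -> i != k -> j = k.
Proof.
move=> le iA jA kA ij ik; apply/eqP; apply: contraTT le => jk; rewrite -ltnNge.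
apply: (@leq_trans #|[set i; j; k]|).
  by rewrite setUC cardsU1 cards2 !inE negb_or ij [k == i]eq_sym ik [k == j]eq_sym jk.
by apply: subset_leq_card; apply/subsetP => x; rewrite !inE => /orP[/orP[]|] /eqP->.
Qed.

(** If another index shares the slope of [e1], then [noD1] makes it unique and [noD2] makes the
    remaining slopes equal. Otherwise all slopes differ from that of [e1], and the bound on the
    indices deviating from [None] leaves at most one exception to a common slope. *)
Lemma slope_pattern n (sigma : option 'I_n -> rat) (e1 : option 'I_n) :
    (0 < n)%N ->
    (forall i j, i != e1 -> j != e1 -> i != j -> sigma i = sigma e1 -> sigma j != sigma e1) ->
    (forall i j k, i != e1 -> j != e1 -> k != e1 -> sigma i = sigma e1 ->
       sigma j != sigma e1 -> sigma k != sigma e1 -> sigma j = sigma k) ->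
    (#|[set i | sigma (Some i) != sigma None]| <= 2)%N ->
  exists r1 c, [/\ e1 != r1, c != sigma e1 &
    forall i, i != e1 -> i != r1 -> sigma i = c].
Proof.
move=> n0 noD1 noD2 le2.
have fill r1 : e1 != r1 ->
    (forall i j, i != e1 -> i != r1 -> j != e1 -> j != r1 -> sigma i = sigma j) ->
    (forall i, i != e1 -> i != r1 -> sigma i != sigma e1) ->
  exists r1 c, [/\ e1 != r1, c != sigma e1 & forall i, i != e1 -> i != r1 -> sigma i = c].
  move=> er same diff; exists r1.
  have [[i [ie ir]]|no] := classic (exists i, i != e1 /\ i != r1).
    by exists (sigma i); split=> // [|j je jr]; [exact: diff | exact: same].
  (* No index is left, so any value other than the slope of [e1] serves as [c]. *)
  exists (sigma e1 + 1); split=> // [|i ie ir]; last by case: no; exists i.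
  by rewrite -subr_eq0 addrAC subrr add0r oner_eq0.
have [[r0 [r0e r0s]]|no] := classic (exists i, i != e1 /\ sigma i = sigma e1).
  have diff i : i != e1 -> i != r0 -> sigma i != sigma e1.
    by move=> ie ir; apply: (noD1 r0 i) => //; rewrite eq_sym.
  apply: (fill r0) => [|i j ie ir je jr|//]; first by rewrite eq_sym.
  by apply: (noD2 r0) => //; apply: diff.
have diff i : i != e1 -> sigma i != sigma e1.
  by move=> ie; apply/eqP => E1; apply: no; exists i.
case: e1 {noD1 noD2 no} fill diff => [i0|] fill diff.
  have i0u : i0 \in [set i | sigma (Some i) != sigma None] by rewrite inE eq_sym diff.
  have [[j [ji ju]]|no] :=
    classic (exists j, j != i0 /\ j \in [set i | sigma (Some i) != sigma None]).
    have par k : k != Some i0 -> k != Some j -> sigma k = sigma None.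
      case: k => // k ki kj; apply/eqP; apply: contraT => ku.
      have ku' : k \in [set i | sigma (Some i) != sigma None] by rewrite inE.
      have E1 : j = k.
        by apply: card_le2 le2 i0u ju ku' _ _; rewrite eq_sym //; apply: contraNneq ki => ->.
      by rewrite E1 eqxx in kj.
    apply: (fill (Some j)) => [|k k' ki kj k'i k'j|k ki _]; last exact: diff.
      by rewrite eq_sym; apply: contraNneq ji => -[->].
    by rewrite !par.
  have par k : k != Some i0 -> sigma k = sigma None.
    case: k => // k ki; apply/eqP; apply: contraT => ku; case: no; exists k.
    by rewrite inE ku; split=> //; apply: contraNneq ki => ->.
  by apply: (fill None) => // [k k' ki _ k'i _|k ki _]; [rewrite !par | exact: diff].
(* Here [e1] is [None] and every other index deviates from it, so there are at most two others: one
   becomes [r1]. *)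
have all_u i : i \in [set i | sigma (Some i) != sigma None] by rewrite inE diff.
apply: (fill (Some (Ordinal n0))) => // [|k ki _]; last exact: diff.
case=> [i|] [j|] //= _ i0 _ j0; congr (sigma (Some _)).
by apply: card_le2 le2 (all_u (Ordinal n0)) (all_u i) (all_u j) _ _;
  rewrite eq_sym; [apply: contraNneq i0 => ->|apply: contraNneq j0 => ->].
Qed.

(** * Kernel vectors of the incidence matrix *)

Section Incidence.

Variable D : wograph.

Local Notation V := 'I_(nvert D).
Local Notation E := 'I_(nedge D).
Implicit Types (x : V) (f g e : E) (y z r : E -> rat) (s p : seq V).

Definition inc x f : nat :=
  if x == tail_of f then 1%N else if x == head_of f then weight x else 0%N.

Lemma inc_eq0 x f : (inc x f == 0%N) = (x \notin ends f).
Proof.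
rewrite /inc /ends !inE; case: (x == tail_of f) => //=; case: (x == head_of f) => //=.
by case: (weight x) (weight_gt0 x).
Qed.

Lemma inc_neq0 x f : x \in ends f -> (inc x f)%:R != 0 :> rat.
Proof. by rewrite pnatr_eq0 inc_eq0 negbK. Qed.

Lemma inc0 x f : x \notin ends f -> inc x f = 0%N.
Proof. by rewrite -inc_eq0 => /eqP. Qed.

Definition act y x : rat := \sum_f (inc x f)%:R * y f.

Lemma eq_act y z x : (forall f, y f = z f) -> act y x = act z x.
Proof. by move=> yz; apply: eq_bigr => f _; rewrite yz. Qed.

Lemma actD y z x : act (fun f => y f + z f) x = act y x + act z x.
Proof. by rewrite -big_split; apply: eq_bigr => f _; rewrite mulrDr. Qed.

Lemma actZ c y x : act (fun f => c * y f) x = c * act y x.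
Proof. by rewrite mulr_sumr; apply: eq_bigr => f _; rewrite mulrCA. Qed.

Lemma act_sum (I : finType) (F : I -> E -> rat) x :
  act (fun f => \sum_i F i f) x = \sum_i act (F i) x.
Proof. by rewrite exchange_big; apply: eq_bigr => f _; rewrite mulr_sumr. Qed.

Lemma act_delta e x : act (fun f => (f == e)%:R) x = (inc x e)%:R.
Proof.
rewrite /act (bigD1 e) //= eqxx mulr1 big1 ?addr0 // => f /negPf->.
by rewrite mulr0.
Qed.

Lemma act0 y x : (forall f, x \in ends f -> y f = 0) -> act y x = 0.
Proof.
move=> y0; rewrite /act big1 // => f _; have [/y0->|/inc0->] := boolP (x \in ends f).
  by rewrite mulr0.
by rewrite mul0r.
Qed.

(* The entries of [act] are sums with nonnegative coefficients. *)
Lemma act_signs y x f : act y x = 0 -> x \in ends f -> y f != 0 ->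
  exists g h, [/\ x \in ends g, x \in ends h, y g > 0 & y h < 0].
Proof.
have main z : act z x = 0 -> x \in ends f -> z f != 0 -> exists2 g, x \in ends g & z g > 0.
  move=> z0 xf zf; apply: NNPP => no.
  have z_le0 g : (inc x g)%:R * z g <= 0.
    have [xg|/inc0->] := boolP (x \in ends g); last by rewrite mul0r.
    rewrite mulr_ge0_le0 // leNgt; apply/negP => zg; apply: no; by exists g.
  have : (inc x f)%:R * z f = 0.
    apply/eqP; move: z0 => /eqP; rewrite /act (bigD1 f) //=.
    have le0 : \sum_(i | i != f) (inc x i)%:R * z i <= 0 by apply: sumr_le0.
    have := z_le0 f; rewrite addr_eq0 => le1 /eqP E1; apply/eqP.
    by apply: le_anti; rewrite le1 E1 oppr_ge0.
  by move/eqP; rewrite mulf_eq0 (negPf (inc_neq0 xf)) (negPf zf).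
move=> y0 xf yf; have [g xg yg] := main y y0 xf yf.
have [||h xh yh] := main (fun f => -1 * y f) _ xf.
- by rewrite actZ y0 mulr0.
- by rewrite mulf_neq0 ?oppr_eq0 ?oner_eq0.
by exists g, h; split=> //; move: yh; rewrite mulN1r oppr_gt0.
Qed.

Definition pedges s : {set E} := [set f | ends f \in consec s].

Definition linked s : Prop := forall X, X \in consec s -> exists f, ends f = X.

Lemma pedgesP s f : f \in pedges s -> {subset ends f <= s}.
Proof. by rewrite inE => /consec_sub/subsetP. Qed.

Lemma ends_injective : injective (@ends D).
Proof. exact: ends_inj. Qed.

(** Each interior vertex meets two path edges, so the entry on one determines the entry on the
    other. Induction adds the first edge of the path. *)
Lemma path_vector x s : linked (x :: s) -> uniq (x :: s) -> s != [::] ->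
  exists r, [/\ forall f, (r f != 0) = (f \in pedges (x :: s)),
    forall v, v != x -> v != last x s -> act r v = 0,
    act r x != 0, act r (last x s) != 0 &
    forall y, (forall f, y f != 0 -> f \in pedges (x :: s)) ->
      (forall v, v != x -> v != last x s -> act y v = 0) ->
      exists t, forall f, y f = t * r f].
Proof.
elim: s x => // x1 s IHs x lk us _.
have [e eE] : exists e, ends e = [set x; x1].
  by apply: lk; rewrite consec_cons !inE eqxx.
have peE f : (f \in pedges [:: x, x1 & s]) = (f == e) || (f \in pedges (x1 :: s)).
  by rewrite !inE consec_cons !inE -eE (inj_eq ends_injective).
have xe : x \in ends e by rewrite eE !inE eqxx.
have x1e : x1 \in ends e by rewrite eE !inE eqxx orbT.
have [s0|s_n0] := eqVneq s [::].
  subst s; have {}peE f : (f \in pedges [:: x; x1]) = (f == e).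
    by rewrite peE [f \in pedges _]inE consec1 inE orbF.
  exists (fun f => (f == e)%:R); split=> /=.
  - by move=> f; rewrite peE pnatr_eq0; case: (f == e).
  - by move=> v vx vx1; rewrite act_delta inc0 // eE !inE negb_or vx.
  - by rewrite act_delta inc_neq0.
  - by rewrite act_delta inc_neq0.
  move=> y ysupp _; exists (y e) => f; have [->|ne] := eqVneq f e; first by rewrite mulr1.
  by rewrite mulr0; apply/eqP/negPn/negP => /ysupp; rewrite peE (negPf ne).
case/andP: us => xs us.
have {IHs} [|r [rE r0 r1 rl rP]] := IHs x1 _ us s_n0.
  by move=> X Xs; apply: lk; rewrite consec_cons !inE Xs orbT.
have x_pe f : f \in pedges (x1 :: s) -> x \notin ends f.
  by move=> /pedgesP fs; apply: contra xs => /fs.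
have e_pe : e \notin pedges (x1 :: s) by apply/negP => /x_pe; rewrite xe.
have re0 : r e = 0 by apply/eqP; rewrite -[_ == 0]negbK rE.
set w := last x (x1 :: s); have wE : w = last x1 s by [].
have ws : w \in s by rewrite wE; case: (s) s_n0 => //= ? ? _; apply: mem_last.
have xx1 : x != x1 by apply: contraNneq xs => ->; rewrite inE eqxx.
have xw : x != w by apply: contraNneq xs => ->; rewrite inE ws orbT.
have x1w : x1 != w by apply: contraTneq us => E; rewrite /= E ws.
pose i1 : rat := (inc x1 e)%:R; have i1_n0 : i1 != 0 by apply: inc_neq0.
have actE v : act (fun f => i1 * r f + - act r x1 * (f == e)%:R) v =
    i1 * act r v - act r x1 * (inc v e)%:R.
  by rewrite (actD (fun f => i1 * r f)) !actZ act_delta mulNr.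
(* The two summands cancel in the row of [x1], which has become interior; multiplying [r] by [i1]
   avoids a division. *)
exists (fun f => i1 * r f + - act r x1 * (f == e)%:R); rewrite -/w; split.
- move=> f; rewrite peE; have [->|ne] := eqVneq f e.
    by rewrite re0 mulr0 add0r mulr1 oppr_eq0 r1.
  by rewrite mulr0 addr0 mulf_eq0 (negPf i1_n0) -rE.
- move=> v vx vw; rewrite actE; have [->|vx1] := eqVneq v x1.
    by rewrite mulrC subrr.
  by rewrite r0 // inc0 ?mulr0 ?subr0 // eE !inE negb_or vx.
- rewrite actE r0 // mulr0 sub0r oppr_eq0 mulf_neq0 //.
  exact: inc_neq0.
- rewrite actE inc0 ?mulr0 ?subr0 ?mulf_neq0 //.
  by rewrite eE !inE negb_or eq_sym xw eq_sym.
move=> y ysupp y0.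
(* Without its entry at [e], [y] lives on the shorter path; the row of [x1] then fixes that
   entry. *)
pose y1 f := y f + - y e * (f == e)%:R.
have y1E v : act y1 v = act y v - y e * (inc v e)%:R by rewrite actD actZ act_delta mulNr.
have y1supp f : y1 f != 0 -> f \in pedges (x1 :: s).
  rewrite /y1; have [->|ne] := eqVneq f e; first by rewrite mulr1 subrr eqxx.
  by rewrite mulr0 addr0 => /ysupp; rewrite peE (negPf ne).
have [v vx1 vw|t tP] := rP y1 y1supp.
  have [->|vx] := eqVneq v x.
    by apply: act0 => f xf; apply/eqP/negPn/negP => /y1supp/x_pe; rewrite xf.
  by rewrite y1E y0 // inc0 ?mulr0 ?subr0 // eE !inE negb_or vx.
have ye : y e * i1 = - (t * act r x1).
  have : act y1 x1 = t * act r x1 by rewrite -actZ; apply: eq_act.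
  have x1x : x1 != x by rewrite eq_sym.
  by rewrite y1E (y0 x1 x1x x1w) sub0r => <-; rewrite opprK.
exists (t / i1) => f; have := tP f; rewrite /y1.
have [->|ne] := eqVneq f e; last by rewrite !mulr0 !addr0 => ->; rewrite mulrA divfK.
rewrite re0 !mulr0 add0r mulr1 => _.
by apply: (mulIf i1_n0); rewrite ye mulrAC divfK // mulr1 mulrN.
Qed.

Lemma linked_sub s p : consec s \subset consec p -> linked p -> linked s.
Proof. by move=> /subsetP sp lp X /sp/lp. Qed.

Lemma card_pedges x s : linked (x :: s) -> uniq (x :: s) -> #|pedges (x :: s)| = size s.
Proof.
elim: s x => [|x1 s IHs] x lk us.
  by apply/eqP; rewrite cards_eq0; apply/eqP/setP => f; rewrite !inE consec1 inE.
have [e eE] : exists e, ends e = [set x; x1].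
  by apply: lk; rewrite consec_cons !inE eqxx.
have -> : pedges [:: x, x1 & s] = e |: pedges (x1 :: s).
  by apply/setP => f; rewrite !inE consec_cons !inE -eE (inj_eq ends_injective).
case/andP: us => xs us; rewrite cardsU1 IHs //; last first.
  by apply: linked_sub lk; rewrite consec_cons subsetUr.
suff -> : e \notin pedges (x1 :: s) by [].
by apply/negP => /pedgesP/(_ x); rewrite eE !inE eqxx => /(_ isT); rewrite -in_cons (negPf xs).
Qed.

Lemma consec_rcons x s v : consec (x :: rcons s v) = [set last x s; v] |: consec (x :: s).
Proof.
rewrite -rcons_cons lastI -cats1 cat_rcons consec_cat -lastI consec_cons consec1 setU0.
by rewrite setUC.
Qed.

(** If [e] joins [y] to its successor, the rotation of the cycle that starts at this successor has
    [e] as its closing edge. *)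
Lemma cycle_split (C : subgraph D) e : is_cycle C -> e \in edges C ->
  exists v s, [/\ uniq (v :: s) /\ (1 < size s)%N, verts C =i v :: s,
    (forall f, (f \in edges C) = (f == e) || (f \in pedges (v :: s))),
    linked (v :: s) & ends e = [set v; last v s]].
Proof.
move=> [s0 [sz us vE eE]] eC.
have /imsetP[y ys ey] : ends e \in [set [set x; next s0 x] | x in s0].
  by rewrite -eE; apply: imset_f.
have [|s ps nE] := cycle_consec_rot (x := next s0 y) us; first by rewrite mem_next.
set v := next s0 y in ps nE ey.
have us' : uniq (v :: s) by rewrite (perm_uniq ps).
have lastE : last v s = y.
  rewrite -(prev_next us y) -(prev_next us (last v s)) -nE; congr prev.
  have -> : last v s = nth v (v :: s) (size s) := esym (nth_last v (v :: s)).
  by rewrite next_nth mem_nth // index_uniq // nth_default.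
have imE : [set ends f | f in edges C] = [set last v s; v] |: consec (v :: s).
  rewrite eE -consec_rcons -cycle_consec //; apply/setP => X.
  by apply/imsetP/imsetP => -[x xs ->]; exists x; rewrite ?nE // ?(perm_mem ps) // -(perm_mem ps).
have eE' : ends e = [set v; last v s] by rewrite ey lastE setUC.
exists v, s; split=> //.
- by split=> //; have /perm_size := ps; move=> /= E1; move: sz; rewrite -E1.
- by move=> x; rewrite vE inE (perm_mem ps).
- move=> f; rewrite -(mem_imset _ _ ends_injective) imE !inE [[set last v s; v]]setUC -eE'.
  by rewrite (inj_eq ends_injective).
- move=> X Xs; have : X \in [set ends f | f in edges C] by rewrite imE !inE Xs orbT.
  by case/imsetP => f _ ->; exists f.
Qed.

Lemma cycle_edge (C : subgraph D) : is_cycle C -> exists e, e \in edges C.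
Proof.
move=> [[|x s] [//= _ us _ eE]].
have : [set x; next (x :: s) x] \in [set ends e | e in edges C].
  by rewrite eE; apply: imset_f; rewrite inE eqxx.
by case/imsetP => e eC _; exists e.
Qed.

(** Makes the matrix in [balanced] square, so that [conform_mx] is a cast and the determinant is the
    intended one. *)
Lemma card_cycle (C : subgraph D) : is_cycle C -> #|edges C| = #|verts C|.
Proof.
move=> cC; have [e eC] := cycle_edge cC.
have [v [s [[us sz] vE eE lk ends_e]]] := cycle_split cC eC.
have -> : edges C = e |: pedges (v :: s) by apply/setP => f; rewrite eE !inE.
rewrite cardsU1 card_pedges // (eq_card vE) (card_uniqP us) /=.
suff -> : e \notin pedges (v :: s) by [].
rewrite inE ends_e; apply/negP => /(consec_ends us); by rewrite leqNgt sz.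
Qed.

Lemma det_conform_eq0 m n (A : 'M[int]_(m, n)) : n = m ->
  reflect (exists v : 'I_n -> rat, (exists j, v j != 0) /\
      forall i, \sum_j (A i j)%:~R * v j = 0)
    (\det (conform_mx (1%:M : 'M[int]_m) A) == 0).
Proof.
move=> nm; case: m / nm A => A; rewrite conform_mx_id.
(* [det0P] speaks of row vectors over a field, hence the transpose and the passage to the
   rationals. *)
have -> : (\det A == 0) = (\det (map_mx intr A^T : 'M[rat]_n) == 0).
  by rewrite det_map_mx det_tr intr_eq0.
apply: (iffP det0P) => [[v v0 vA]|[v [[j vj] vA]]].
  exists (v 0); split.
    apply/existsP; rewrite -negb_forall; apply: contra v0 => /forallP v0.
    by apply/eqP/rowP => j; rewrite mxE (eqP (v0 j)).
  move=> i; have /rowP/(_ i) := vA; rewrite !mxE => vAi; rewrite -[RHS]vAi.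
  by apply: eq_bigr => j _; rewrite !mxE mulrC.
exists (\row_j v j); first by apply: contra vj => /eqP/rowP/(_ j); rewrite !mxE => ->.
apply/rowP => i; rewrite !mxE -[RHS](vA i).
by apply: eq_bigr => k _; rewrite !mxE mulrC.
Qed.

(** Frees balancedness from enumerations by using vectors on all edges of [D]; rows at vertices off
    the cycle vanish on vectors supported on it. *)
Lemma balancedP (C : subgraph D) : is_cycle C ->
  reflect (exists y, [/\ exists f, y f != 0, forall f, y f != 0 -> f \in edges C &
             forall x, act y x = 0])
    (balanced C).
Proof.
move=> cC; have incE i j : incidence_mx C i j = (inc (enum_val i) (enum_val j))%:Z.
  by rewrite mxE /inc /=; case: eqP => // _; case: eqP.
apply: (iffP (det_conform_eq0 _ (card_cycle cC))) => [[v [[j vj] vA]]|[y [[f yf] ysupp y0]]].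
  pose y f := \sum_(j < #|edges C|) if enum_val j == f then v j else 0.
  have yE k : y (enum_val k) = v k.
    rewrite /y -big_mkcond /= (big_pred1 k) // => i.
    by rewrite (inj_eq enum_val_inj).
  have ysupp f : f \notin edges C -> y f = 0.
    move=> fC; rewrite /y big1 // => i _; case: eqP => // fE.
    by rewrite -fE enum_valP in fC.
  exists y; split=> [|f|x]; first by exists (enum_val j); rewrite yE.
    by apply: contraR => /ysupp->.
  have [xC|xC] := boolP (x \in verts C); last first.
    apply: act0 => f xf; apply: ysupp; apply: contra xC => fC.
    exact: (subsetP (ends_sub fC)).
  rewrite -(enum_rankK_in xC xC) -[RHS](vA (enum_rank_in xC x)).
  rewrite /act (bigID (mem (edges C))) /= [X in _ + X]big1 ?addr0 => [|f /ysupp->]; last first.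
    by rewrite mulr0.
  by rewrite big_enum_val; apply: eq_bigr => k _; rewrite yE incE.
exists (fun j => y (enum_val j)); split.
  exists (enum_rank_in (ysupp _ yf) f).
  by rewrite enum_rankK_in ?ysupp.
move=> i; rewrite -[RHS](y0 (enum_val i)) /act [RHS](bigID (mem (edges C))) /=.
rewrite [X in _ = _ + X]big1 ?addr0 => [|g gC]; last first.
  by case: (eqVneq (y g) 0) => [->|/ysupp]; rewrite ?mulr0 ?(negPf gC).
by rewrite [RHS]big_enum_val; apply: eq_bigr => k _; rewrite incE.
Qed.

Lemma cycle_path_vector (C : subgraph D) e : is_cycle C -> e \in edges C ->
  exists r, [/\ forall f, (r f != 0) = (f \in edges C :\ e),
    forall v, v \notin ends e -> act r v = 0,
    forall v, v \in ends e -> act r v != 0,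
    forall y, (forall f, y f != 0 -> f \in edges C :\ e) ->
      (forall v, v \notin ends e -> act y v = 0) -> exists t, forall f, y f = t * r f &
    exists v f, [/\ v \in verts C, v \notin ends e, v \in ends f & f \in edges C :\ e]].
Proof.
move=> cC eC; have [v [s [[us sz] vE eE lk ends_e]]] := cycle_split cC eC.
have [|r [rE r0 rv rl rP]] := path_vector lk us; first by case: (s) sz.
have e_pe : e \notin pedges (v :: s).
  by rewrite inE ends_e; apply/negP => /(consec_ends us); rewrite leqNgt sz.
have peE f : (f \in pedges (v :: s)) = (f \in edges C :\ e).
  by rewrite in_setD1 eE; have [->|] := eqVneq f e; rewrite ?(negPf e_pe).
exists r; split.
- by move=> f; rewrite rE peE.
- by move=> x; rewrite ends_e !inE negb_or => /andP[]; apply: r0.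
- by move=> x; rewrite ends_e !inE => /orP[]/eqP->.
- move=> y ysupp y0; apply: rP => [f /ysupp|x xv xl]; first by rewrite peE.
  by apply: y0; rewrite ends_e !inE negb_or xv.
(* The second vertex of the path: as [s] has at least two entries, it is not the last one, so it is
   no end of [e]. *)
pose x := nth v s 0; have xs : x \in v :: s by rewrite inE mem_nth ?orbT // ltnW.
have xe : x \notin ends e.
  rewrite ends_e !inE -nth_last negb_or; apply/andP; split.
    by case/andP: us => vs _; apply: contraNneq vs => <-; apply: mem_nth; apply: ltnW.
  by rewrite /x nth_uniq; [case: (s) sz => // ? [] // | | | by case/andP: us]; case: (s) sz.
have [|X Xs xX] := consec_mem xs; first by rewrite /= ltnW.
have [f fX] := lk X Xs.
by exists x, f; split; rewrite ?vE ?fX // -peE inE fX.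
Qed.

(** * Circuits and the failure of robustness *)

Section Circuits.

Definition amon f : 'X_{1..nvert D} :=
  (U_(tail_of f) + U_(head_of f) *+ weight (head_of f))%MM.

Lemma amonE f x : amon f x = inc x f.
Proof.
rewrite mnmDE mulmnE !mnm1E /inc [tail_of f == x]eq_sym [head_of f == x]eq_sym.
have [->|_] := eqVneq x (tail_of f); first by rewrite (negPf (loopless f)).
by have [->|_] := eqVneq x (head_of f); rewrite ?mul1n.
Qed.

Lemma amon_neq0 f : amon f != 0%MM.
Proof. by rewrite mnmD_eq0 mnm1_eq0. Qed.

Lemma toric_idealE (K : fieldType) : @toric_ideal K D = toric (K := K) amon.
Proof.
rewrite /toric_ideal /toric.
have -> : [tuple 'X_(tail_of e) * 'X_(head_of e) ^+ weight (head_of e) | e < nedge D] =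
    [tuple 'X_[amon e] | e < nedge D] :> (nedge D).-tuple {mpoly K[nvert D]}.
  by apply: eq_from_tnth => e; rewrite !tnth_mktuple mpolyXD mpolyXn.
by [].
Qed.

Implicit Types (u v w : 'X_{1..nedge D}).

Lemma act_adeg u x : act (fun f => (u f)%:R) x = (adeg amon u x)%:R.
Proof.
rewrite mnm_sumE natr_sum; apply: eq_bigr => f _.
by rewrite mulmnE amonE natrM.
Qed.

Lemma adeg_actP u v : adeg amon u = adeg amon v <->
  forall x, act (fun f => (u f)%:R - (v f)%:R) x = 0.
Proof.
have actB x : act (fun f => (u f)%:R - (v f)%:R) x = (adeg amon u x)%:R - (adeg amon v x)%:R.
  rewrite -!act_adeg -sumrB; apply: eq_bigr => f _; exact: mulrBr.
split=> [uv x|uv]; first by rewrite actB uv subrr.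
by apply/mnmP => x; apply/eqP; rewrite -(eqr_nat rat) -subr_eq0 -actB uv.
Qed.

Lemma common_denominator z : exists2 c : rat, c != 0 &
  exists m : E -> int, forall f, c * z f = (m f)%:~R.
Proof.
exists (\prod_f denq (z f))%:~R.
  by rewrite intr_eq0; apply/prodf_neq0 => f _; apply: denq_neq0.
exists (fun f => numq (z f) * \prod_(g | g != f) denq (z g)) => f.
by rewrite (bigD1 f) //= !rmorphM /= numqE mulrC mulrA.
Qed.

(** In place of minimal support, the second clause has the form needed for
    [circuit_universal_groebner]: in the variables of [u] and [v] the fiber has no third
    monomial. *)
Definition circuit u v : Prop :=
  primitive amon u v /\
  forall w, adeg amon w = adeg amon u ->
    (forall f, w f != 0%N -> (u f != 0%N) || (v f != 0%N)) -> w = u \/ w = v.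

Lemma circuit_sym u v : circuit u v -> circuit v u.
Proof.
move=> [uv circ]; split; first exact: primitive_sym.
move=> w Ew supp; have [|f /supp|->|->] := circ w; [by case: uv => _ -> | |by right|by left].
by rewrite orbC.
Qed.

(* A pair of least total degree among those supported in the support of [z] is a
   circuit. *)
Lemma circuit_exists z :
    (exists f, z f != 0) -> (forall x, act z x = 0) ->
    (forall y, (forall f, y f != 0 -> z f != 0) -> (forall x, act y x = 0) ->
       exists t, forall f, y f = t * z f) ->
  exists u v c, [/\ c != 0, forall f, (u f)%:R - (v f)%:R = c * z f & circuit u v].
Proof.
move=> [f0 zf0] z0 line.
pose pair u v := [/\ u != v, adeg amon u = adeg amon v &
  forall f, (u f != 0%N) || (v f != 0%N) -> z f != 0].
have [u0 [v0 p0]] : exists u v, pair u v.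
  have [c c0 [m mE]] := common_denominator z.
  (* [u] and [v] are the positive and negative parts of an integral multiple of [z]. *)
  pose u := [multinom if (0 <= m f)%R then absz (m f) else 0%N | f < nedge D].
  pose v := [multinom if (0 <= m f)%R then 0%N else absz (m f) | f < nedge D].
  have uvE f : (u f)%:R - (v f)%:R = (m f)%:~R :> rat.
    rewrite !mnmE; case: ifP => [m0|/negbT]; first by rewrite subr0 natr_absz ger0_norm.
    by rewrite -ltNge => m0; rewrite sub0r natr_absz ltr0_norm // rmorphN opprK.
  exists u, v; split.
  - apply: contra zf0 => /eqP uv; rewrite -[z f0 == 0]orFb -(negPf c0) -mulf_eq0 mE.
    by rewrite -uvE uv subrr.
  - apply/adeg_actP => x; rewrite (eq_act (z := fun f => c * z f)) ?actZ ?z0 ?mulr0 //.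
    by move=> f; rewrite uvE mE.
  - move=> f; rewrite !mnmE => uvf; have : m f != 0.
      by apply: contraTneq uvf => ->.
    by apply: contra => /eqP zf; rewrite -(intr_eq0 rat) -mE zf mulr0.
have [u [v [[uv E supp] min]]] : exists u v, pair u v /\
    forall u' v', pair u' v' -> (mdeg u + mdeg v <= mdeg u' + mdeg v')%N.
  have [k] := ubnP (mdeg u0 + mdeg v0)%N; elim: k u0 v0 p0 => // k IHk u v p lt.
  have [[u' [v' [p' lt']]]|no] :=
    classic (exists u' v', pair u' v' /\ (mdeg u' + mdeg v' < mdeg u + mdeg v)%N).
    by apply: IHk p' _; apply: leq_trans lt' _.
  exists u, v; split=> // u' v' p'; rewrite leqNgt; apply/negP => lt'.
  by apply: no; exists u', v'.
have mdeg_eq (a b : 'X_{1..nedge D}) : (a <= b)%MM -> (mdeg b <= mdeg a)%N -> a = b.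
  move=> ab; rewrite -{1}(submK ab) mdegD => le.
  have /eqP : mdeg (b - a)%MM = 0%N by lia.
  by rewrite mdeg_eq0 => /eqP E'; rewrite -(submK ab) E' add0m.
have mdeg_le (a b : 'X_{1..nedge D}) : (a <= b)%MM -> (mdeg a <= mdeg b)%N.
  by move=> ab; rewrite -(submK ab) mdegD leq_addl.
have prim : primitive amon u v.
  split=> // u' v' uv' E' le1 le2; have p' : pair u' v'.
    split=> // f uvf; apply: supp; move/mnm_lepP/(_ f): le1; move/mnm_lepP/(_ f): le2.
    by lia.
  have := min _ _ p'; have := mdeg_le _ _ le1; have := mdeg_le _ _ le2.
  by move=> d2 d1 d; split; apply: mdeg_eq => //; lia.
have cop f : u f = 0%N \/ v f = 0%N.
  have [u0f|uf] := eqVneq (u f) 0%N; [by left|right]; apply/eqP/negPn/negP => vf.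
  have := @primitive_coprime _ _ amon u v U_(f)%MM prim.
  by rewrite !lep1mP => /(_ uf vf)/eqP; rewrite mnm1_eq0.
have [t tE] : exists t, forall f, (u f)%:R - (v f)%:R = t * z f.
  apply: line => [f|]; last exact/adeg_actP.
  by move=> uvf; apply: supp; apply: contraNT uvf; rewrite negb_or !negbK => /andP[/eqP-> /eqP->].
have t0 : t != 0.
  apply: contra uv => /eqP t0; apply/eqP/mnmP => f; apply/eqP.
  by rewrite -(eqr_nat rat) -subr_eq0 tE t0 mul0r.
exists u, v, t; split=> //; split=> // w Ew wsupp.
have [t1 sE] : exists t1, forall f, (u f)%:R - (w f)%:R = t1 * z f.
  apply: line => [f|]; last exact/adeg_actP/esym.
  move=> uwf; apply: supp; apply: contraNT uwf => uvf.
  have /eqP-> : w f == 0%N by apply: contraNT uvf => /wsupp.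
  by move: uvf; rewrite negb_or !negbK => /andP[/eqP-> _]; rewrite subrr.
(* [w] lies on the line through [u] and [v]. Nonnegativity of [w] at a variable of [u] and at one of
   [v] puts [k] between 0 and 1, whence [w] is bounded by [u + v]. *)
pose k := t1 / t.
have kE f : (u f)%:R - (w f)%:R = k * ((u f)%:R - (v f)%:R) by rewrite sE tE mulrA divfK.
have exu u' v' : u' != v' -> adeg amon u' = adeg amon v' -> exists f, u' f != 0%N.
  move=> ne Euv; apply: NNPP => no; have u0' : u' = 0%MM.
    by apply/mnmP => f; rewrite mnm0E; apply/eqP/negPn/negP => uf; apply: no; exists f.
  case/eqP: ne; rewrite u0'; apply/esym/eqP; rewrite -(adeg_eq0 amon_neq0) -Euv u0'.
  by rewrite (adeg_eq0 amon_neq0).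
have [f uf] := exu _ _ uv E; have [g vg] : exists g, v g != 0%N.
  by apply: (exu v u); rewrite // eq_sym.
have k1 : k <= 1.
  have vf : v f = 0%N by case: (cop f) => // uf0; rewrite uf0 eqxx in uf.
  have uf' : 0 < (u f)%:R :> rat by rewrite ltr0n lt0n.
  have wf' : 0 <= (w f)%:R :> rat by rewrite ler0n.
  have := kE f; rewrite vf; nra.
have k0 : 0 <= k.
  have ug : u g = 0%N by case: (cop g) => // vg0; rewrite vg0 eqxx in vg.
  have vg' : 0 < (v g)%:R :> rat by rewrite ltr0n lt0n.
  have wg' : 0 <= (w g)%:R :> rat by rewrite ler0n.
  have := kE g; rewrite ug; nra.
apply: (primitive_le_add prim Ew); apply/mnm_lepP => h; rewrite mnmDE -(ler_nat rat) natrD.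
have uh : 0 <= (u h)%:R :> rat by rewrite ler0n.
have vh : 0 <= (v h)%:R :> rat by rewrite ler0n.
by have := kE h; nra.
Qed.

Definition not_robust (K : fieldType) : Prop :=
  [/\ ~ strongly_robust K D, ~ robust K D, ~ generalized_robust K D & ~ weakly_robust K D].

Section BalancedCycle.

Variables (K : fieldType) (B : {set E}) (e : E) (r : E -> rat) (alpha : rat).
Hypothesis eB : e \in B.
Hypothesis r_supp : forall f, r f != 0 -> f \in B :\ e.
Hypothesis r_act : forall x, act r x = alpha * (inc x e)%:R.

Let r0 f : f \notin B :\ e -> r f = 0.
Proof. by move=> fB; apply/eqP/negPn/negP => /r_supp; rewrite (negPf fB). Qed.

(* [w] replaces the part of [u] on [B - e] by that of [v] and adds [a] copies of [e]. *)
Lemma circuit_not_robust_pos u v k (a : nat) f1 f2 :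
    circuit u v -> (forall f, f \in B -> (u f)%:R - (v f)%:R = k * r f) ->
    k * alpha = a%:R -> f1 \notin B -> u f1 != 0%N -> f2 \in B -> v f2 != 0%N ->
  not_robust K.
Proof.
move=> [uv circ] uvE ka f1B uf1 f2B vf2; have [ne E' _] := uv.
have cop : forall c, (c <= u)%MM -> (c <= v)%MM -> c = 0%MM.
  by move=> c; apply: primitive_coprime uv.
(* Where [r] vanishes on [B], [u] and [v] agree, so both vanish by coprimality. *)
have uve f : r f = 0 -> f \in B -> u f = 0%N /\ v f = 0%N.
  move=> rf fB; have /eqP := uvE f fB; rewrite rf mulr0 subr_eq0 eqr_nat => /eqP uf.
  suff u0 : u f = 0%N by rewrite -uf u0.
  apply/eqP/negPn/negP => uf0; have := cop U_(f)%MM; rewrite !lep1mP -uf => /(_ uf0 uf0)/eqP.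
  by rewrite mnm1_eq0.
have [ue ve] : u e = 0%N /\ v e = 0%N by apply: uve => //; apply: r0; rewrite !inE eqxx.
pose w := [multinom if f \in B then if f == e then a else v f else u f | f < nedge D].
have Ew : adeg amon w = adeg amon u.
  apply/adeg_actP => x.
  rewrite (eq_act (z := fun f => - k * r f + a%:R * (f == e)%:R)) => [|f].
    by rewrite actD !actZ act_delta r_act mulrA mulNr ka mulNr addNr.
  rewrite mnmE; have [->|fe] := eqVneq f e.
    by rewrite eB ue subr0 mulr1 r0 ?mulr0 ?add0r // !inE eqxx.
  rewrite mulr0 addr0 mulNr; case: ifP => fB; first by rewrite -uvE // opprB.
  by rewrite subrr r0 ?mulr0 ?oppr0 // !inE fB andbF.
have we : f2 != e by apply: contraNneq vf2 => ->; rewrite ve.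
rewrite /not_robust /strongly_robust /robust /generalized_robust /weakly_robust.
rewrite toric_idealE.
apply: (bad_circuit K amon_neq0 ne E' cop circ Ew uf1 _ vf2).
  by rewrite mnmE (negPf f1B).
by rewrite mnmE f2B (negPf we).
Qed.

(** The circuit is [z] scaled by some [c]. The integer [c * k * alpha] is the number of copies of
    [e]; if it is negative, [u] and [v] change roles. The sign assumptions make the third monomial
    share variables with both. *)
Lemma circuit_not_robust z k :
    (exists f, z f != 0) -> (forall x, act z x = 0) ->
    (forall y, (forall f, y f != 0 -> z f != 0) -> (forall x, act y x = 0) ->
       exists t, forall f, y f = t * z f) ->
    (forall f, f \in B -> z f = k * r f) ->
    (exists f g, [/\ f \in B, g \in B, z f > 0 & z g < 0]) ->
    (exists f g, [/\ f \notin B, g \notin B, z f > 0 & z g < 0]) ->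
  not_robust K.
Proof.
move=> zn0 z0 line zB signB signQ.
have [u [v [c [c0 uvE circ]]]] := circuit_exists zn0 z0 line.
have uvB f : f \in B -> (u f)%:R - (v f)%:R = c * k * r f.
  by move=> fB; rewrite uvE zB // mulrA.
have signs (P : pred E) : (exists f g, [/\ P f, P g, z f > 0 & z g < 0]) ->
    (exists2 f, P f & u f != 0%N) /\ (exists2 f, P f & v f != 0%N).
  move=> [f [g [Pf Pg zf zg]]].
  have posu h : 0 < c * z h -> u h != 0%N.
    by rewrite -uvE; apply: contraTneq => ->; rewrite sub0r oppr_gt0 -leNgt ler0n.
  have posv h : c * z h < 0 -> v h != 0%N.
    by rewrite -uvE; apply: contraTneq => ->; rewrite subr0 -leNgt ler0n.
  have [cpos|cneg|ceq] := ltgtP 0 c; last by rewrite -ceq eqxx in c0.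
    by split; [exists f | exists g] => //; [apply: posu|apply: posv]; nra.
  by split; [exists g | exists f] => //; [apply: posu|apply: posv]; nra.
have [[fu fuB ufu] [fv fvB vfv]] := signs (mem B) signB.
have [[gu guB ugu] [gv gvB vgv]] := signs (fun f => f \notin B) signQ.
have [N NE] : exists N : int, c * k * alpha = N%:~R.
  (* The row at the tail of [e], applied to the part of [u - v] on [B]. It is integral, and as the
     entry of [e] in this row is 1, it equals the left side. *)
  exists (\sum_(f in B) (inc (tail_of e) f)%:Z * ((u f)%:Z - (v f)%:Z)).
  have inc1 : inc (tail_of e) e = 1%N by rewrite /inc eqxx.
  rewrite -[alpha]mulr1 -[1 in LHS]/(1%:R) -inc1 -r_act -actZ rmorph_sum /act.
  rewrite (bigID (mem B)) /= [X in _ + X]big1 ?addr0 => [|f fB]; last first.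
    by rewrite r0 ?mulr0 // !inE (negPf fB) andbF.
  by apply: eq_bigr => f fB; rewrite -uvB // rmorphM rmorphB.
have [a [Na|Na]] : exists a : nat, N = a \/ N = - a%:Z.
  by case: N {NE} => a; [exists a; left | exists a.+1; right; rewrite NegzE].
  by apply: (circuit_not_robust_pos (a := a) circ uvB _ guB ugu fvB vfv); rewrite NE Na.
have vuB f : f \in B -> (v f)%:R - (u f)%:R = - (c * k) * r f.
  by move=> fB; rewrite mulNr -uvB // opprB.
apply: (circuit_not_robust_pos (circuit_sym circ) vuB (a := a) _ gvB vgv fuB ufu).
by rewrite mulNr NE Na rmorphN opprK.
Qed.

End BalancedCycle.

End Circuits.

Definition path_of (C : subgraph D) e r : Prop :=
  [/\ forall f, (r f != 0) = (f \in edges C :\ e),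
    forall v, v \notin ends e -> act r v = 0,
    forall v, v \in ends e -> act r v != 0 &
    forall y, (forall f, y f != 0 -> f \in edges C :\ e) ->
      (forall v, v \notin ends e -> act y v = 0) -> exists t, forall f, y f = t * r f].

Definition inner (C : subgraph D) e (v : V) f : Prop :=
  [/\ v \in verts C, v \notin ends e, v \in ends f & f \in edges C :\ e].

Lemma path_of_exists (C : subgraph D) e : is_cycle C -> e \in edges C ->
  exists r v f, path_of C e r /\ inner C e v f.
Proof.
move=> cC eC; have [r [r1 r2 r3 r4 [v [f vf]]]] := cycle_path_vector cC eC.
by exists r, v, f.
Qed.

Section PathOf.

Variables (C : subgraph D) (e : E) (r : E -> rat).
Hypothesis rP : path_of C e r.

Lemma path_of0 f : f \notin edges C :\ e -> r f = 0.
Proof. by case: rP => rE _ _ _; rewrite -rE negbK => /eqP. Qed.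

Lemma path_of_supp f : r f != 0 -> f \in edges C.
Proof. by case: rP => rE _ _ _; rewrite rE => /setD1P[]. Qed.

Lemma path_of_closing : r e = 0.
Proof. by apply: path_of0; rewrite !inE eqxx. Qed.

(* A kernel vector on the balanced cycle is a combination of [r] and of the
   indicator of [e]. *)
Lemma balanced_path_act : is_cycle C -> balanced C ->
  exists2 alpha, alpha != 0 & forall x, act r x = alpha * (inc x e)%:R.
Proof.
move=> cC /(balancedP cC)[y [[f yf] ysupp y0]]; have [rE r0 rn0 line] := rP.
pose y1 g := y g + - y e * (g == e)%:R.
have y1E x : act y1 x = - y e * (inc x e)%:R by rewrite actD actZ act_delta y0 add0r.
have [g|v ve|t tE] := line y1.
- rewrite /y1 !inE; have [->|ne] := eqVneq g e; first by rewrite mulr1 subrr eqxx.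
  by rewrite mulr0 addr0; apply: ysupp.
- by rewrite y1E inc0 // mulr0.
have actE x : t * act r x = - y e * (inc x e)%:R by rewrite -actZ -y1E; apply: eq_act.
have te : tail_of e \in ends e by rewrite !inE eqxx.
have inc1 : (inc (tail_of e) e)%:R = 1 :> rat by rewrite /inc eqxx.
have := actE (tail_of e); rewrite inc1 mulr1 => tail_eq.
have t0 : t != 0.
  apply: contra yf => /eqP t0; move: tail_eq; rewrite t0 mul0r => /esym/eqP; rewrite oppr_eq0.
  move=> /eqP ye; have := tE f; rewrite /y1 ye t0 oppr0 !mul0r addr0 => ->; exact: eqxx.
have ye : y e != 0.
  by rewrite -oppr_eq0 -tail_eq mulf_neq0 // rn0.
exists (- y e / t); first by rewrite mulf_neq0 ?invr_eq0 ?oppr_eq0.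
by move=> x; apply: (mulfI t0); rewrite actE mulrA mulrCA divff // mulr1.
Qed.

(** At an interior vertex of the path the support of [y] uses edges of [C] only, so the part of [y]
    on [C] is killed by the interior rows as well and lies on the line of [r]. *)
Lemma restrict_path y : y e = 0 -> (forall x, act y x = 0) ->
    (forall f v, y f != 0 -> f \notin edges C -> v \in ends f -> v \in verts C -> v \in ends e) ->
  exists t, forall f, f \in edges C -> y f = t * r f.
Proof.
move=> ye y0 ysep; have [_ _ _ line] := rP.
pose yC f := if f \in edges C then y f else 0.
have [f|v ve|t tE] := line yC; last by exists t => f fC; rewrite -tE /yC fC.
  rewrite /yC !inE; case: ifP => [_|]; last by rewrite eqxx.
  by rewrite andbT; apply: contraNneq => ->; rewrite ye.
have [vC|vC] := boolP (v \in verts C); last first.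
  apply: act0 => f vf; rewrite /yC; case: ifP => // /ends_sub/subsetP/(_ v vf).
  by rewrite (negPf vC).
rewrite -[RHS](y0 v); apply: eq_bigr => f _; rewrite /yC; case: ifP => // /negbT fC.
have [vf|/inc0->] := boolP (v \in ends f); last by rewrite !mul0r.
have [->//|yf] := eqVneq (y f) 0.
by rewrite (ysep f v yf fC vf vC) in ve.
Qed.

End PathOf.

(** * Subgraphs of type D_1 and D_2 *)

Lemma share_edge_eq e (C1 C2 : subgraph D) f :
  share_edge e C1 C2 -> f \in edges C1 -> f \in edges C2 -> f = e.
Proof. by move=> [_ /setP/(_ f)]; rewrite !inE => + f1 f2; rewrite f1 f2 => /esym/eqP. Qed.

Lemma share_edge_verts e (C1 C2 : subgraph D) v :
  share_edge e C1 C2 -> v \in verts C1 -> v \in verts C2 -> v \in ends e.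
Proof. by move=> [/setP/(_ v) + _]; rewrite in_setI => + v1 v2; rewrite v1 v2. Qed.

Lemma share_edge_mem e (C1 C2 : subgraph D) :
  share_edge e C1 C2 -> e \in edges C1 /\ e \in edges C2.
Proof. by move=> [_ /setP/(_ e)]; rewrite !inE eqxx => /andP. Qed.

Lemma edge_vert (C : subgraph D) f v : f \in edges C -> v \in ends f -> v \in verts C.
Proof. by move=> /ends_sub/subsetP; apply. Qed.

Lemma inner_signs (C : subgraph D) e v f z : inner C e v f -> (forall x, act z x = 0) ->
    z f != 0 ->
  exists g h, [/\ v \in ends g, v \in ends h, z g > 0 & z h < 0].
Proof. by move=> [_ _ vf _] z0; apply: act_signs. Qed.

(** Both paths act as multiples of [e], so a combination [z] of them is in the kernel. Kernel
    vectors on its support are multiples of [z]: each path carries a line, and the row at the tail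
    of [e] fixes the ratio. Interior vertices of the two paths provide both signs inside and outside
    [B1]. *)
Lemma type_D1_not_robust (K : fieldType) (H : subgraph D) : type_D1 H -> not_robust K.
Proof.
move=> [e [B1 [B2 [[c1 b1] [c2 b2] sh _ _]]]]; have [eB1 eB2] := share_edge_mem sh.
have [r1 [v1 [f1 [P1 in1]]]] := path_of_exists c1 eB1.
have [r2 [v2 [f2 [P2 in2]]]] := path_of_exists c2 eB2.
have [a1 a1n0 act1] := balanced_path_act P1 c1 b1.
have [a2 a2n0 act2] := balanced_path_act P2 c2 b2.
have [E1 _ _ _] := P1; have [E2 _ _ _] := P2.
pose z f := a2 * r1 f + - a1 * r2 f.
have z0 x : act z x = 0 by rewrite actD !actZ act1 act2; ring.
have z1 f : f \in edges B1 -> z f = a2 * r1 f.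
  move=> fB; rewrite /z (path_of0 P2) ?mulr0 ?addr0 // in_setD1 negb_and negbK.
  have [fB2|] := boolP (f \in edges B2); last by rewrite orbT.
  by rewrite (share_edge_eq sh fB fB2) eqxx.
have z2 f : f \in edges B2 -> z f = - a1 * r2 f.
  move=> fB; rewrite /z (path_of0 P1) ?mulr0 ?add0r // in_setD1 negb_and negbK.
  have [fB1|] := boolP (f \in edges B1); last by rewrite orbT.
  by rewrite (share_edge_eq sh fB1 fB) eqxx.
have zsupp f : z f != 0 -> (f \in edges B1) || (f \in edges B2).
  apply: contraR; rewrite negb_or => /andP[n1 n2].
  by rewrite /z (path_of0 P1) ?(path_of0 P2) ?mulr0 ?addr0 // in_setD1 negb_and ?n1 ?n2 orbT.
have ze : z e = 0 by rewrite z1 // (path_of_closing P1) mulr0.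
have zf1 : z f1 != 0.
  by case: in1 => _ _ _ f1B; rewrite z1 ?mulf_neq0 ?E1 //; case/setD1P: f1B.
have zf2 : z f2 != 0.
  by case: in2 => _ _ _ f2B; rewrite z2 ?mulf_neq0 ?oppr_eq0 ?E2 //; case/setD1P: f2B.
apply: (circuit_not_robust K eB1 (r := r1) (alpha := a1) _ _ (z := z) (k := a2)) => //.
- by move=> f; rewrite E1.
- by exists f1.
- move=> y ysupp y0; have ye : y e = 0 by apply/eqP/negPn/negP => /ysupp; rewrite ze eqxx.
  have ysplit f : y f != 0 -> (f \in edges B1) || (f \in edges B2) by move=> /ysupp/zsupp.
  have [f v yf nf vf vB|t1 y1] := restrict_path P1 ye y0.
    have := ysplit f yf; rewrite (negPf nf) => fB2.
    exact: (share_edge_verts sh vB (edge_vert fB2 vf)).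
  have [f v yf nf vf vB|t2 y2] := restrict_path P2 ye y0.
    have := ysplit f yf; rewrite (negPf nf) orbF => fB1.
    exact: (share_edge_verts sh (edge_vert fB1 vf) vB).
  have yE f : y f = t1 * r1 f + t2 * r2 f.
    have [fB1|n1] := boolP (f \in edges B1).
      rewrite y1 // -[LHS]addr0; congr (_ + _).
      have := z1 f fB1; rewrite /z -[RHS]addr0 => /addrI/eqP.
      by rewrite mulf_eq0 oppr_eq0 (negPf a1n0) => /eqP->; rewrite mulr0.
    rewrite (path_of0 P1) ?mulr0 ?add0r; last by rewrite in_setD1 (negPf n1) andbF.
    have [fB2|n2] := boolP (f \in edges B2); first exact: y2.
    rewrite (path_of0 P2) ?mulr0; last by rewrite in_setD1 (negPf n2) andbF.
    by apply/eqP/negPn/negP => /ysplit; rewrite (negPf n1) (negPf n2).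
  have te : t1 * a1 + t2 * a2 = 0.
    have := y0 (tail_of e); rewrite (eq_act _ yE) actD !actZ act1 act2 /inc eqxx.
    by rewrite !mulr1.
  exists (t1 / a2) => f; rewrite yE /z; have -> : t2 = - (t1 * a1) / a2.
    by apply: (mulIf a2n0); rewrite divfK //; lra.
  by field.
- have [g [h [vg vh zg zh]]] := inner_signs in1 z0 zf1; exists g, h.
  have inB k : v1 \in ends k -> z k != 0 -> k \in edges B1.
    case: in1 => v1B v1e _ _ vk /zsupp/orP[//|kB2].
    by rewrite (share_edge_verts sh v1B (edge_vert kB2 vk)) in v1e.
  by split=> //; apply: inB; rewrite // ?(gt_eqF zg) ?(lt_eqF zh).
- have [g [h [vg vh zg zh]]] := inner_signs in2 z0 zf2; exists g, h.
  have ninB k : v2 \in ends k -> k \notin edges B1.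
    case: in2 => v2B v2e _ _ vk; apply: contra v2e => kB1.
    exact: (share_edge_verts sh (edge_vert kB1 vk) v2B).
  by split=> //; apply: ninB.
Qed.

(** The expression is the determinant formed by the values of [e] and [r] at the two ends of [e];
    were it zero, [r] minus a multiple of [e] would be a kernel vector on [C]. *)
Lemma unbalanced_slope (C : subgraph D) e r : path_of C e r -> is_cycle C -> e \in edges C ->
    ~~ balanced C ->
  act r (head_of e) - (inc (head_of e) e)%:R * act r (tail_of e) != 0.
Proof.
move=> rP cC eC; apply: contra => /eqP d0; have [rE r0 rn0 _] := rP.
have inc1 : (inc (tail_of e) e)%:R = 1 :> rat by rewrite /inc eqxx.
apply/(balancedP cC); exists (fun f => r f + - act r (tail_of e) * (f == e)%:R); split.
- exists e; rewrite (path_of_closing rP) add0r eqxx mulr1 oppr_eq0 rn0 //.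
  by rewrite !inE eqxx.
- move=> f; have [->//|fe] := eqVneq f e.
  by rewrite mulr0 addr0; apply: (path_of_supp rP).
move=> x; rewrite actD actZ act_delta.
have [|xe] := boolP (x \in ends e); last by rewrite r0 // inc0 // mulr0 addr0.
rewrite !inE => /orP[]/eqP->; first by rewrite inc1; ring.
by rewrite -[RHS]d0; ring.
Qed.

(** The combination of [r'] and [r''] with coefficients [d''] and [- d'] acts at the ends of [e] as
    [gam] times [e], and the balanced path cancels this. The coefficients are nonzero because [C']
    and [C''] are unbalanced, and [gam] because the fourth cycle is. *)
Lemma type_D2_not_robust (K : fieldType) (H : subgraph D) : type_D2 H -> not_robust K.
Proof.
move=> [e [B [C' [C'' [C3 [[cB bB] [c' u' c'' u''] [sh1 sh2 sh3] [c3 C3E u3] _]]]]]].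
have [eB eC'] := share_edge_mem sh1; have [_ eC''] := share_edge_mem sh2.
have [r [v [f0 [P inB]]]] := path_of_exists cB eB.
have [r' [v' [f' [P' in']]]] := path_of_exists c' eC'.
have [r'' [v'' [f'' [P'' _]]]] := path_of_exists c'' eC''.
have [a an0 actB] := balanced_path_act P cB bB.
have d'n0 := unbalanced_slope P' c' eC' u'.
have d''n0 := unbalanced_slope P'' c'' eC'' u''.
have [E0 _ _ _] := P; have [E1 r'0 _ _] := P'; have [E2 r''0 _ _] := P''.
set wt : rat := (inc (head_of e) e)%:R in d'n0 d''n0.
have inc1 : (inc (tail_of e) e)%:R = 1 :> rat by rewrite /inc eqxx.
set A' := act r' (tail_of e) in d'n0; set A'' := act r'' (tail_of e) in d''n0.
set H' := act r' (head_of e) in d'n0; set H'' := act r'' (head_of e) in d''n0.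
pose d' := H' - wt * A'; pose d'' := H'' - wt * A''.
rewrite -/d' in d'n0; rewrite -/d'' in d''n0.
pose gam := d'' * A' - d' * A''.
have notin (C1 C2 : subgraph D) f : share_edge e C1 C2 -> f \in edges C1 ->
    f \notin edges C2 :\ e.
  move=> sh fC1; rewrite in_setD1 negb_and negbK.
  have [fC2|] := boolP (f \in edges C2); last by rewrite orbT.
  by rewrite (share_edge_eq sh fC1 fC2) eqxx.
have notin' (C1 C2 : subgraph D) f : share_edge e C1 C2 -> f \in edges C2 ->
    f \notin edges C1 :\ e.
  move=> sh fC2; rewrite in_setD1 negb_and negbK.
  have [fC1|] := boolP (f \in edges C1); last by rewrite orbT.
  by rewrite (share_edge_eq sh fC1 fC2) eqxx.
have f'C : f' \in edges C' by case: in' => _ _ _ /setD1P[].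
have r'f' : r' f' != 0 by case: in' => _ _ _; rewrite E1.
have act_ends y : (forall x, x \notin ends e -> act y x = 0) -> act y (tail_of e) = 0 ->
    act y (head_of e) = 0 -> forall x, act y x = 0.
  move=> out yt yh x; have [|/out//] := boolP (x \in ends e).
  by rewrite !inE => /orP[]/eqP->.
have gam_n0 : gam != 0.
  apply: contra u3 => /eqP g0; apply/(balancedP c3).
  exists (fun f => d'' * r' f + - d' * r'' f); split.
  - exists f'; rewrite (path_of0 P'') ?mulr0 ?addr0 ?mulf_neq0 //.
    exact: (notin C').
  - move=> f; apply: contraR; rewrite C3E in_setD1 in_setU => nf.
    by rewrite (path_of0 P') ?(path_of0 P'') ?mulr0 ?addr0 // in_setD1; apply: contra nf;
      case/andP=> -> ->; rewrite ?orbT.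
  apply: act_ends => [x xe||]; rewrite actD !actZ.
  - by rewrite r'0 // r''0 // !mulr0 addr0.
  - by rewrite -[RHS]g0 mulNr.
  rewrite -/H' -/H''; have -> : d'' * H' + - d' * H'' = wt * gam by rewrite /gam /d' /d''; ring.
  by rewrite g0 mulr0.
pose z f := - gam / a * r f + (d'' * r' f + - d' * r'' f).
have z0 : forall x, act z x = 0.
  apply: act_ends => [x xe||]; rewrite actD actZ actD !actZ actB.
  - by rewrite r'0 // r''0 // inc0 // !mulr0 !addr0.
  - by rewrite inc1 -/A' -/A'' /gam; field.
  - by rewrite -/wt -/H' -/H'' /gam /d' /d''; field.
have zB f : f \in edges B -> z f = - gam / a * r f.
  move=> fB; rewrite /z (path_of0 P') ?(path_of0 P'') ?mulr0 ?addr0 //;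
    [exact: notin sh2 _ | exact: notin sh1 _].
have zC' f : f \in edges C' -> z f = d'' * r' f.
  move=> fB; rewrite /z (path_of0 P) ?(path_of0 P'') ?mulr0 ?addr0 ?add0r //;
    [exact: notin sh3 _ | exact: notin' sh1 _].
have zC'' f : f \in edges C'' -> z f = - d' * r'' f.
  move=> fB; rewrite /z (path_of0 P) ?(path_of0 P') ?mulr0 ?addr0 ?add0r //;
    [exact: notin' sh3 _ | exact: notin' sh2 _].
have znone f : f \notin edges B -> f \notin edges C' -> f \notin edges C'' -> z f = 0.
  move=> n0 n1 n2; rewrite /z (path_of0 P) ?(path_of0 P') ?(path_of0 P'') ?mulr0 ?addr0 //;
  by rewrite in_setD1 negb_and ?n0 ?n1 ?n2 orbT.
have ze : z e = 0 by rewrite zB // (path_of_closing P) mulr0.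
have zf0 : z f0 != 0.
  case: inB => _ _ _ f0B; rewrite zB; last by case/setD1P: f0B.
  by rewrite !mulf_neq0 ?invr_eq0 ?oppr_eq0 ?E0.
have zf' : z f' != 0 by rewrite zC' // mulf_neq0.
apply: (circuit_not_robust K eB (r := r) (alpha := a) _ _ (z := z) (k := - gam / a)) => //.
- by move=> f; rewrite E0.
- by exists f0.
- move=> y ysupp y0; have ye : y e = 0 by apply/eqP/negPn/negP => /ysupp; rewrite ze eqxx.
  have ynone f : f \notin edges B -> f \notin edges C' -> f \notin edges C'' -> y f = 0.
    by move=> n0 n1 n2; apply/eqP/negPn/negP => /ysupp; rewrite znone ?eqxx.
  have [f x yf nf xf xB|t yB] := restrict_path P ye y0.
    have [fC'|nC'] := boolP (f \in edges C').
      exact: (share_edge_verts sh1 xB (edge_vert fC' xf)).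
    have [fC''|nC''] := boolP (f \in edges C'').
      exact: (share_edge_verts sh2 xB (edge_vert fC'' xf)).
    by rewrite ynone ?eqxx in yf.
  have [f x yf nf xf xC|t' yC'] := restrict_path P' ye y0.
    have [fB|nB] := boolP (f \in edges B).
      exact: (share_edge_verts sh1 (edge_vert fB xf) xC).
    have [fC''|nC''] := boolP (f \in edges C'').
      exact: (share_edge_verts sh3 xC (edge_vert fC'' xf)).
    by rewrite ynone ?eqxx in yf.
  have [f x yf nf xf xC|t'' yC''] := restrict_path P'' ye y0.
    have [fB|nB] := boolP (f \in edges B).
      exact: (share_edge_verts sh2 (edge_vert fB xf) xC).
    have [fC'|nC'] := boolP (f \in edges C').
      exact: (share_edge_verts sh3 (edge_vert fC' xf) xC).
    by rewrite ynone ?eqxx in yf.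
  have yE f : y f = t * r f + (t' * r' f + t'' * r'' f).
    have [fB|nB] := boolP (f \in edges B).
      by rewrite yB // (path_of0 P') ?(path_of0 P'') ?mulr0 ?addr0 //;
    [exact: notin sh2 _ | exact: notin sh1 _].
    have [fC'|nC'] := boolP (f \in edges C').
      by rewrite yC' // (path_of0 P) ?(path_of0 P'') ?mulr0 ?addr0 ?add0r //;
    [exact: notin sh3 _ | exact: notin' sh1 _].
    have [fC''|nC''] := boolP (f \in edges C'').
      by rewrite yC'' // (path_of0 P) ?(path_of0 P') ?mulr0 ?addr0 ?add0r //;
    [exact: notin' sh3 _ | exact: notin' sh2 _].
    by rewrite ynone // (path_of0 P) ?(path_of0 P') ?(path_of0 P'') ?mulr0 ?addr0 //;
      rewrite in_setD1 negb_and ?nB ?nC' ?nC'' orbT.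
  have := y0 (tail_of e); rewrite (eq_act _ yE) actD actZ actD !actZ actB inc1 mulr1 -/A' -/A''.
  have := y0 (head_of e); rewrite (eq_act _ yE) actD actZ actD !actZ actB -/wt -/H' -/H''.
  (* Subtracting [wt] times the tail row from the head row eliminates [t] and relates [t'] to
     [t'']. *)
  move=> eqh eqt; have dd : t' * d' + t'' * d'' = 0.
    by rewrite /d' /d'' -[RHS]subr0 -[X in _ = _ - X](mulr0 wt) -{1}eqh -eqt; ring.
  have t''E : t'' = - (t' * d') / d''.
    by apply: (mulIf d''n0); rewrite divfK //; lra.
  have tE : t = - (t' / d'' * gam) / a.
    apply: (mulIf an0); rewrite divfK // /gam.
    have -> : - (t' / d'' * (d'' * A' - d' * A'')) = - (t' * A' + t'' * A'').
      by rewrite t''E; field.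
    by lra.
  by exists (t' / d'') => f; rewrite yE /z tE t''E; field; rewrite an0 d''n0.
- have [g [h [vg vh zg zh]]] := inner_signs inB z0 zf0; exists g, h.
  have inB' k : v \in ends k -> z k != 0 -> k \in edges B.
    case: inB => vB ve _ _ vk; apply: contraR => nB.
    rewrite znone //; apply: contra ve => kC.
      exact: (share_edge_verts sh1 vB (edge_vert kC vk)).
    exact: (share_edge_verts sh2 vB (edge_vert kC vk)).
  by split=> //; apply: inB'; rewrite // ?(gt_eqF zg) ?(lt_eqF zh).
- have [g [h [vg vh zg zh]]] := inner_signs in' z0 zf'; exists g, h.
  have ninB k : v' \in ends k -> k \notin edges B.
    case: in' => vC ve _ _ vk; apply: contra ve => kB.
    exact: (share_edge_verts sh1 (edge_vert kB vk) vC).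
  by split=> //; apply: ninB.
Qed.

(** Vertices of the walk other than [a] occur in it once. A simple path along pairs of the walk that
    has passed from [x] to [y] cannot turn back to [x], so it continues with the next vertex of the
    walk. *)
Lemma walk_prefix (W p h t : seq V) (x y a : V) : W = h ++ [:: x, y & t] ->
    (forall (v : V) h1 t1, v != a -> W = h1 ++ v :: t1 -> v \notin h1 /\ v \notin t1) ->
    consec (y :: p) \subset consec W -> uniq [:: x, y & p] -> a \notin y :: p ->
  exists q, t = p ++ q.
Proof.
elim: p h x y t => [|z p IHp] h x y t WE cnt sub us ap; first by exists t.
have ya : y != a by apply: contraNneq ap => ->; rewrite inE eqxx.
have zx : z != x by apply: contraTneq us => ->; rewrite /= !inE eqxx orbT.
have [yh yt] : y \notin h /\ y \notin t.
  have [|+ ->] := cnt y (rcons h x) t ya; first by rewrite WE cat_rcons.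
  by rewrite mem_rcons inE negb_or => /andP[].
have xy : x != y by apply: contraTneq us => ->; rewrite /= !inE eqxx.
have [t' tE] : exists t', t = z :: t'.
  have yz : y \in [set y; z] by rewrite !inE eqxx.
  have : [set y; z] \in consec W by apply: (subsetP sub); rewrite consec_cons !inE eqxx.
  rewrite WE consec_cat consec_cons !inE => /or3P[/consec_sub/subsetP/(_ y yz)|/eqP/setP/(_ z)|].
  - by rewrite mem_rcons inE eq_sym (negPf xy) (negPf yh).
  - rewrite !inE eqxx orbT (negPf zx) /= => /esym/eqP zy; move: us.
    by rewrite zy /= !inE eqxx /= andbF.
  case: (t) yt => [|t0 t1] yt; first by rewrite consec1 inE.
  rewrite consec_cons !inE => /orP[/eqP/setP/(_ z)|/consec_sub/subsetP/(_ y yz)].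
    rewrite !inE eqxx orbT => /esym/orP[/eqP zy|/eqP->]; last by exists t1.
    by move: us; rewrite zy /= !inE eqxx /= andbF.
  by move=> yt'; rewrite yt' in yt.
have [||||q qE] := IHp (rcons h x) y z t' _ cnt.
- by rewrite WE tE cat_rcons.
- by apply: subset_trans sub; rewrite consec_cons subsetUr.
- by case/andP: us.
- by apply: contra ap => az; rewrite in_cons az orbT.
by exists q; rewrite tE qE.
Qed.

(** The path leaves [a] towards one of its two neighbours on the cycle; in one case the cycle is
    read as given, in the other backwards. *)
Lemma cycle_prefix (s p : seq V) (a y : V) :
    uniq (a :: s) -> (1 < size s)%N -> uniq [:: a, y & p] ->
    consec [:: a, y & p] \subset consec (a :: rcons s a) ->
  exists q, perm_eq (a :: s) ([:: a, y & p] ++ q) /\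
    consec (a :: rcons s a) = consec (rcons ([:: a, y & p] ++ q) a).
Proof.
move=> us sz up sub; have ya : y != a by case/andP: up; rewrite inE negb_or eq_sym => /andP[].
have main s' : uniq (a :: s') -> (0 < size s')%N -> y = head a s' ->
    consec [:: a, y & p] \subset consec (a :: rcons s' a) -> exists q, s' = y :: p ++ q.
  case: s' => // x s' us' _ /= yx sub'; rewrite -yx {x yx} in us' sub' *.
  have cnt (v : V) h1 t1 : v != a -> a :: y :: rcons s' a = h1 ++ v :: t1 ->
      v \notin h1 /\ v \notin t1.
    move=> va; case/lastP: t1 => [|t1 z].
      by rewrite cats1 -!rcons_cons => /rcons_inj[_ av]; rewrite av eqxx in va.
    rewrite -!rcons_cons -rcons_cat => /rcons_inj[E1 <-].
    move: us'; rewrite E1 uniq_catC /= cat_uniq mem_cat mem_rcons inE !negb_or va.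
    by case/andP => /andP[-> ->].
  have [|||q qE] := walk_prefix (p := p) (h := [::]) (t := rcons s' a) (erefl _) cnt.
  - by apply: subset_trans sub'; rewrite (consec_cons a y p) subsetUr.
  - exact: up.
  - by case/andP: up.
  (* What is left of the closed walk ends in the second copy of [a]; it is not empty, since the path
     does not return to [a]. *)
  case/lastP: q qE => [|q z] qE.
    have := congr1 (last y) qE; rewrite last_rcons cats0 => E1.
    by case/andP: up => /negP[]; rewrite E1 mem_last.
  by exists q; move: qE; rewrite -rcons_cat => /rcons_inj[->].
have ayC : [set a; y] \in consec (a :: rcons s a).
  by apply: (subsetP sub); rewrite consec_cons !inE eqxx.
have s0 : (0 < size s)%N by apply: ltnW.
have catE q : a :: rcons (y :: p ++ q) a = rcons ([:: a, y & p] ++ q) a by [].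
case s_eq: s us sz s0 sub ayC => [//|x s1] us sz s0 sub ayC; rewrite -s_eq in us sz s0 sub ayC *.
have cE : consec (a :: rcons s a) = [set a; x] |: consec (rcons s a) by rewrite s_eq consec_cons.

move: ayC; rewrite cE in_setU1 -{}cE => /orP[/eqP/setP/(_ y)|].
  rewrite !inE eqxx orbT (negPf ya) => /esym/eqP yx.
  have [|q qE] := main s us s0 _ sub; first by rewrite s_eq.
  by exists q; rewrite qE catE.
have sE : s = rcons (belast x s1) (last x s1) by rewrite s_eq lastI.
rewrite {1}sE -cats1 cat_rcons consec_cat -lastI -s_eq consec_cons consec1 setU0 in_setU in_set1.
case/orP=> [/consec_sub/subsetP/(_ a)|/eqP/setP/(_ y)].
  by rewrite !inE eqxx => /(_ isT) as_; case/andP: us; rewrite as_.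
rewrite !inE eqxx orbT (negPf ya) orbF => /esym/eqP yl.
have revE : consec (a :: rcons (rev s) a) = consec (a :: rcons s a).
  by rewrite -(consec_rev (a :: rcons s a)) rev_cons rev_rcons.
have [|||| q qE] := main (rev s).
- by rewrite /= mem_rev rev_uniq.
- by rewrite size_rev.
- by rewrite sE rev_rcons.
- by rewrite revE.
exists q; split; last by rewrite -revE qE catE.
by rewrite -[_ ++ q]/(a :: (y :: p ++ q)) -qE perm_cons perm_sym perm_rev.
Qed.

Lemma cycle_through_path (C : subgraph D) (p : seq V) (a b : V) :
    is_cycle C -> uniq (a :: rcons p b) ->
    consec (a :: rcons p b) \subset [set ends f | f in edges C] ->
  exists q, [/\ uniq ((a :: rcons p b) ++ q), verts C =i (a :: rcons p b) ++ q,
    [set ends f | f in edges C] = consec (rcons ((a :: rcons p b) ++ q) a) &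
    (2 < size ((a :: rcons p b) ++ q))%N].
Proof.
move=> [s0 [sz us vE eE]] up sub.
have [y [p' pE]] : exists (y : V) (p' : seq V), rcons p b = y :: p'.
  by case: (p) => [|x p1]; [exists b, [::] | exists x, (rcons p1 b)].
rewrite pE in up sub *.
have as0 : a \in s0.
  have : [set a; y] \in [set ends f | f in edges C].
    by apply: (subsetP sub); rewrite consec_cons !inE eqxx.
  rewrite eE => /imsetP[x xs /setP/(_ a)]; rewrite !inE eqxx => /esym/orP[]/eqP->//.
  by rewrite mem_next.
have [s ps nE] := cycle_consec_rot us as0.
have us' : uniq (a :: s) by rewrite (perm_uniq ps).
have imE : [set ends f | f in edges C] = consec (a :: rcons s a).
  rewrite eE -cycle_consec //; apply/setP => X.
  by apply/imsetP/imsetP => -[x xs ->]; exists x; rewrite ?nE // ?(perm_mem ps) // -(perm_mem ps).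
have szs : (2 < size (a :: s))%N by rewrite (perm_size ps).
rewrite imE in sub; have [q [pq cE]] := cycle_prefix us' szs up sub.
exists q; split.
- by rewrite -(perm_uniq pq).
- by move=> x; rewrite vE inE -(perm_mem ps) (perm_mem pq).
- by rewrite imE cE.
- by rewrite -(perm_size pq).
Qed.

(** * Cycles sharing a path *)

Section Theta.

Variables (n : nat) (a b : V) (l : option 'I_n -> seq V).

Definition strand i : seq V := a :: rcons (l i) b.

(** A generalized theta graph. For cycles sharing a path, [None] stands for this path and [Some i]
    for the rest of the cycle [i]. By the last clause at most one strand is a single edge. *)
Definition theta : Prop :=
  [/\ forall i, uniq (strand i),
    forall i j v, i != j -> v \in l i -> v \notin l j,
    forall i, linked (strand i),
    forall f, exists i, f \in pedges (strand i) &
    forall i j, l i = [::] -> l j = [::] -> i = j].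

Hypothesis th : theta.

Lemma mem_strand i v : (v \in strand i) = (v == a) || (v == b) || (v \in l i).
Proof. by rewrite inE mem_rcons inE orbA. Qed.

Lemma strand_ends i v : v \in l i -> v != a /\ v != b.
Proof.
move=> vl; case: th => /(_ i) us _ _ _ _; split; apply: contraTneq us => vE;
  rewrite /strand /=.
  by rewrite mem_rcons inE -vE vl orbT.
by rewrite rcons_uniq -vE vl andbF.
Qed.

Lemma strand_edge_empty i f : f \in pedges (strand i) -> ends f = [set a; b] -> l i = [::].
Proof.
rewrite inE => + fE; rewrite fE; case: th => /(_ i) us _ _ _ _.
rewrite -[b in [set a; b]](last_rcons a (l i)) => /(consec_ends us).
by rewrite size_rcons; case: (l i).
Qed.

(** A common edge has its ends on both strands, so it joins [a] to [b]; then both strands are single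
    edges. *)
Lemma strand_disjoint i j f : f \in pedges (strand i) -> f \in pedges (strand j) -> i = j.
Proof.
have [_ dis _ _ emp] := th.
move=> fi fj; have [//|ij] := eqVneq i j.
have fab v : v \in ends f -> (v == a) || (v == b).
  move=> vf; have := pedgesP fi vf; have := pedgesP fj vf; rewrite !mem_strand.
  case: (boolP ((v == a) || (v == b))) => //= _ vj vi.
  by have := dis _ _ _ ij vi; rewrite vj.
have fE : ends f = [set a; b].
  have te : tail_of f \in ends f by rewrite !inE eqxx.
  have he : head_of f \in ends f by rewrite !inE eqxx orbT.
  have := loopless f; rewrite /ends.
  case/orP: (fab _ te) => /eqP->; case/orP: (fab _ he) => /eqP->; rewrite ?eqxx // => _.
  exact: setUC.
by apply: emp; apply: strand_edge_empty; eassumption.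
Qed.

Lemma theta_cycle i j : i != j -> exists C : subgraph D,
  [/\ is_cycle C, edges C = pedges (strand i) :|: pedges (strand j) &
    verts C = [set v in strand i ++ strand j]].
Proof.
have [us dis lk _ emp] := th; move=> ij.
pose W : {set V} := [set v in strand i ++ strand j].
have sub f : f \in pedges (strand i) :|: pedges (strand j) -> ends f \subset W.
  rewrite in_setU => /orP[]/pedgesP fs; apply/subsetP => v /fs vs;
  by rewrite inE mem_cat vs ?orbT.
exists (Subgraph sub); split=> //.
(* Along the strand [i] from [a] to [b] and back along [j]; there are more than two vertices because
   at most one of the strands is a single edge. *)
exists (a :: l i ++ b :: rev (l j)).
have us' : uniq (a :: l i ++ b :: rev (l j)).
  have := us i; have := us j; rewrite /strand /= !mem_rcons !inE !rcons_uniq !negb_or.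
  case/andP=> /andP[ab aj] /andP[bj uj] /andP[/andP[_ ai] /andP[bi ui]].
  rewrite mem_cat inE mem_rev !negb_or ab ai aj /= cat_uniq /= mem_rev rev_uniq ui bj uj /=.
  rewrite negb_or bi /= andbT; apply/hasPn => v; rewrite mem_rev => vj.
  by apply/negP => vi; have := dis _ _ _ ij vi; rewrite vj.
split=> //.
- rewrite /= size_cat /= size_rev addnS !ltnS lt0n addn_eq0 !size_eq0.
  by apply: contra ij => /andP[/eqP Ei /eqP Ej]; apply/eqP/emp.
- apply/setP => v; rewrite !inE mem_cat !mem_strand mem_cat inE mem_rev.
  rewrite mem_rcons inE.
  by case: (v == a); case: (v == b); case: (v \in l i); rewrite ?orbT.
rewrite cycle_consec //.
have -> : consec (a :: rcons (l i ++ b :: rev (l j)) a) = consec (strand i) :|: consec (strand j).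
  rewrite rcons_cat -cat_cons rcons_cons consec_cat; congr (_ :|: _).
  by rewrite -(consec_rev (strand j)) /strand rev_cons rev_rcons.
apply/setP => X; apply/imsetP/idP => [[f] /=|].
  by rewrite !inE => fs ->.
rewrite in_setU => Xs; have [f fX] : exists f, ends f = X by case/orP: Xs => /lk.
by exists f => //=; rewrite !inE fX.
Qed.

End Theta.

Lemma union_along_path_theta n (P : subgraph D) (C : 'I_n -> subgraph D) :
    (0 < n)%N -> union_along_path P C ->
  exists a b l, @theta n a b l /\
    forall i, edges (C i) = pedges (strand a b l None) :|: pedges (strand a b l (Some i)).
Proof.
move=> n0 [cyc [_ eU] [p0 [sz up vP eP]] sub inter].
have [a [p [b p0E]]] : exists a p b, p0 = a :: rcons p b.
  by case: (p0) sz => // a; elim/last_ind => // p b _ _; exists a, p, b.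
have {}eP : [set ends f | f in edges P] = consec (a :: rcons p b) by rewrite eP p0E.
rewrite {sz}p0E in up vP.
have conP i : consec (a :: rcons p b) \subset [set ends f | f in edges (C i)].
  by rewrite -eP; apply: imsetS; case: (sub i) => -[].
have /fin_all_exists[q qP] i := cycle_through_path (cyc i) up (conP i).
(* [q i] runs from [b] back to [a] while strands run from [a] to [b], hence the reversal. *)
pose l (o : option 'I_n) := if o is Some i then rev (q i) else p.
have conC i : [set ends f | f in edges (C i)] =
    consec (strand a b l None) :|: consec (strand a b l (Some i)).
  have [_ _ -> _] := qP i; rewrite /strand /=.
  rewrite rcons_cat cat_rcons -cat_cons consec_cat rcons_cons; congr (_ :|: _).
  by rewrite -consec_rev rev_cons rev_rcons.
have eC i f : (f \in edges (C i)) =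
    (f \in pedges (strand a b l None)) || (f \in pedges (strand a b l (Some i))).
  by rewrite -(mem_imset _ _ ends_injective) conC !inE.
have eP' f : (f \in edges P) = (f \in pedges (strand a b l None)).
  by rewrite -(mem_imset _ _ ends_injective) eP inE.
have uq i : uniq ((a :: rcons p b) ++ q i) by case: (qP i).
have vq i v : v \in q i -> v \notin a :: rcons p b.
  move=> vq; have := uq i; rewrite cat_uniq => /and3P[_ /hasPn/(_ v vq) + _]; exact.
have ab : a \in a :: rcons p b /\ b \in a :: rcons p b.
  by split; rewrite in_cons ?eqxx // mem_rcons inE eqxx orbT.
have us o : uniq (strand a b l o).
  case: o => [i|]; last exact: up.
  rewrite /strand /= mem_rcons inE negb_or rcons_uniq !mem_rev rev_uniq.
  have qa v : v \in a :: rcons p b -> v \notin q i.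
    by apply: contraL => /vq.
  rewrite !qa; try (by case: ab); rewrite andbT.
  have := uq i; rewrite cat_uniq => /and3P[/andP[/= + _] _ ->].
  by rewrite mem_rcons inE negb_or => /andP[->].
have empN i : l (Some i) = [::] -> l None <> [::].
  rewrite /l => /(congr1 rev); rewrite revK => qi pE; have [_ _ _] := qP i.
  by rewrite qi pE.
have Cij i j f : i != j -> f \in edges (C i) -> f \in edges (C j) -> f \in edges P.
  by move=> ij fi fj; have [_ <-] := inter i j ij; rewrite inE fi.
exists a, b, l; split; last by move=> i; apply/setP => f; rewrite eC in_setU.
have lk i o : o = None \/ o = Some i -> linked (strand a b l o).
  move=> oE X Xs; have : X \in [set ends f | f in edges (C i)].
    by rewrite conC in_setU; case: oE Xs => -> ->; rewrite ?orbT.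
  by case/imsetP => f _ ->; exists f.
split=> //.
- have dN i v : v \in l (Some i) -> v \notin l None.
    by rewrite /l mem_rev => /vq; rewrite inE mem_rcons inE !negb_or => /and3P[].
  move=> [i|] [j|] v ij //; [|exact: dN|by apply: contraL; apply: dN].
  move=> vi; apply/negP => vj; have {ij} ij : i != j by apply: contraNneq ij => ->.
  have [vPE _] := inter i j ij; move: vi vj; rewrite /l !mem_rev => vi vj.
  have : v \in verts (C i) :&: verts (C j).
    have [_ vi' _ _] := qP i; have [_ vj' _ _] := qP j.
    by rewrite inE vi' vj' !mem_cat vi vj !orbT.
  by rewrite vPE vP inE (negPf (vq _ _ vi)).
- move=> [i|]; first by apply: (lk i); right.
  by apply: (lk (Ordinal n0)); left.
- move=> f; have : f \in \bigcup_i edges (C i) by rewrite eU inE.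
  case/bigcupP => i _; rewrite eC => /orP[fi|fi]; first by exists None.
  by exists (Some i).
move=> [i|] [j|] Ei Ej //; [|by case: (empN i)|by case: (empN j)].
apply/eqP; apply: contraT => ij; have {ij} ij : i != j by apply: contraNneq ij => ->.
(* Two single-edge strands would be one edge from [a] to [b] in two cycles, hence on [P]. Then [P]
   would be this edge too, leaving a cycle with only two vertices. *)
have sE o : l o = [::] -> [set a; b] \in consec (strand a b l o).
  by move=> lo; rewrite /strand lo /= consec_cons !inE eqxx.
have [f fE] := lk i (Some i) (or_intror erefl) _ (sE _ Ei).
have fpe o : l o = [::] -> f \in pedges (strand a b l o) by move=> lo; rewrite /pedges in_set fE sE.
have : f \in edges P by apply: (Cij i j) => //; rewrite eC ?(fpe _ Ei) ?(fpe _ Ej) orbT.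
rewrite eP' inE fE -[b in [set a; b]](last_rcons a p) => /(consec_ends (us None)).
by rewrite size_rcons ltnS leqn0 size_eq0 => /eqP pE; case: (empN i Ei).
Qed.

(** * Kernel vectors and slopes of strands *)

Section ThetaKernel.

Variables (n : nat) (a b : V) (l : option 'I_n -> seq V).
Hypothesis th : theta a b l.

Local Notation strand := (strand a b l).

Definition strand_vector i (ri : E -> rat) : Prop :=
  [/\ forall f, (ri f != 0) = (f \in pedges (strand i)),
    forall v, v != a -> v != b -> act ri v = 0,
    act ri a != 0, act ri b != 0 &
    forall y, (forall f, y f != 0 -> f \in pedges (strand i)) ->
      (forall v, v != a -> v != b -> act y v = 0) -> exists t, forall f, y f = t * ri f].

Lemma strand_vectors : exists r : option 'I_n -> E -> rat, forall i, strand_vector i (r i).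
Proof.
suff /fin_all_exists[r rP] : forall i, exists ri, strand_vector i ri by exists r.
move=> i; have [us _ lk _ _] := th.
have [|r] := path_vector (lk i) (us i); first by case: (l i).
by rewrite last_rcons => rP; exists r; exact: rP.
Qed.

Variable r : option 'I_n -> E -> rat.
Hypothesis rP : forall i, strand_vector i (r i).

Definition slope i : rat := act (r i) b / act (r i) a.

Lemma strand_vector0 i j f : f \in pedges (strand i) -> i != j -> r j f = 0.
Proof.
move=> fi ij; case: (rP j) => rE _ _ _ _; apply/eqP; rewrite -[_ == _]negbK rE.
by apply: contra ij => fj; apply/eqP/(strand_disjoint th fi fj).
Qed.

Lemma strand_signs i : l i != [::] -> exists f g, 0 < r i f /\ r i g < 0.
Proof.
case: (rP i) => rE r0 _ _ _; have [us _ lk _ _] := th.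
case li: (l i) => [//|v s0] _; have vl : v \in l i by rewrite li inE eqxx.
have [va vb] := strand_ends th vl.
have vs : v \in strand i by rewrite mem_strand vl orbT.
have [|X Xs vX] := consec_mem vs; first by rewrite /= size_rcons.
have [f fX] := lk i X Xs.
have [||g [h [_ _ rg rh]]] := act_signs (r0 v va vb) (f := f).
- by rewrite fX.
- by rewrite rE inE fX.
by exists g, h.
Qed.

(** Interior vertices lie on one strand only, so the part of [y] on a strand is killed by its
    interior rows and is a multiple of the strand vector. What remains are the rows at [a] and
    [b]. *)
Lemma theta_kernel y : (forall x, act y x = 0) ->
  exists t : option 'I_n -> rat,
    [/\ forall i f, f \in pedges (strand i) -> y f = t i * r i f,
        \sum_i t i * act (r i) a = 0 &
        \sum_i t i * act (r i) a * slope i = 0].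
Proof.
move=> y0; have [us dis lk cov _] := th.
pose yi i f := if f \in pedges (strand i) then y f else 0.
have /fin_all_exists[t tE] i : exists ti, forall f, yi i f = ti * r i f.
  case: (rP i) => _ _ _ _ line; apply: line => [f|v va vb].
    by rewrite /yi; case: ifP => // _; rewrite eqxx.
  have [vl|vl] := boolP (v \in l i); last first.
    apply: act0 => f vf; rewrite /yi; case: ifP => // /pedgesP/(_ v vf).
    by rewrite mem_strand (negPf va) (negPf vb) (negPf vl).
  rewrite -[RHS](y0 v); apply: eq_bigr => f _; rewrite /yi; case: ifP => // /negbT fi.
  have [vf|/inc0->] := boolP (v \in ends f); last by rewrite !mul0r.
  have [j fj] := cov f; have ij : i != j by apply: contraNneq fi => ->.
  have := pedgesP fj vf; rewrite mem_strand (negPf va) (negPf vb) (negPf (dis _ _ _ ij vl)).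
  by [].
have yE f : y f = \sum_i t i * r i f.
  have [i fi] := cov f; rewrite (bigD1 i) //= big1 ?addr0 => [|j ji].
    by rewrite -tE /yi fi.
  by rewrite (strand_vector0 fi) ?mulr0 // eq_sym.
have actE x : \sum_i t i * act (r i) x = 0.
  rewrite -[RHS](y0 x) (eq_act _ yE) act_sum; apply: eq_bigr => i _.
  by rewrite actZ.
exists t; split=> [i f fi||]; first by rewrite -tE /yi fi.
  exact: actE.
rewrite -[RHS](actE b); apply: eq_bigr => i _; rewrite /slope -mulrA; congr (_ * _).
by case: (rP i) => _ _ ra _ _; rewrite mulrCA divff ?mulr1.
Qed.

(** For equal slopes, the combination of the two strand vectors that cancels at [a] also cancels at
    [b]. For different slopes, the rows at [a] and [b] force both coefficients to vanish. *)
Lemma theta_balanced (C : subgraph D) i j : is_cycle C -> i != j ->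
    edges C = pedges (strand i) :|: pedges (strand j) ->
  balanced C = (slope i == slope j).
Proof.
move=> cC ij CE; have [rEi ri0 ria _ _] := rP i; have [rEj rj0 rja _ _] := rP j.
have [us dis lk cov _] := th.
apply/(balancedP cC)/eqP => [[y [[f yf] ysupp y0]]|sl]; last first.
  have [f fi] : exists f, f \in pedges (strand i).
    have vs : a \in strand i by rewrite mem_strand eqxx.
    have [|X Xs vX] := consec_mem vs; first by rewrite /= size_rcons.
    by have [f fX] := lk i X Xs; exists f; rewrite inE fX.
  exists (fun f => act (r j) a * r i f + - act (r i) a * r j f); split.
  - exists f; rewrite (strand_vector0 fi ij) mulr0 addr0 mulf_neq0 //.
    by rewrite rEi.
  - move=> g; apply: contraR; rewrite CE in_setU negb_or => /andP[gi gj].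
    have /eqP-> : r i g == 0 by rewrite -[_ == _]negbK rEi.
    have /eqP-> : r j g == 0 by rewrite -[_ == _]negbK rEj.
    by rewrite !mulr0 addr0.
  move=> x; rewrite actD !actZ.
  have [->|xa] := eqVneq x a; first by ring.
  have [->|xb] := eqVneq x b; last by rewrite (ri0 x) // (rj0 x) // !mulr0 addr0.
  have Ei : act (r i) b = slope i * act (r i) a by rewrite divfK.
  have Ej : act (r j) b = slope j * act (r j) a by rewrite divfK.
  by rewrite Ei Ej sl; ring.
have [t [tE ta tb]] := theta_kernel y0.
have t0 k : k != i -> k != j -> t k = 0.
  move=> ki kj; have [rEk _ _ _ _] := rP k.
  have [g gk] : exists f, f \in pedges (strand k).
    have vs : a \in strand k by rewrite mem_strand eqxx.
    have [|X Xs vX] := consec_mem vs; first by rewrite /= size_rcons.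
    by have [g gX] := lk k X Xs; exists g; rewrite inE gX.
  have yg : y g = 0.
    apply/eqP/negPn/negP => /ysupp; rewrite CE in_setU => /orP[gi|gi].
      by rewrite (strand_disjoint th gk gi) eqxx in ki.
    by rewrite (strand_disjoint th gk gi) eqxx in kj.
  have := tE k g gk; rewrite yg => /esym/eqP; rewrite mulf_eq0 => /orP[/eqP//|rk0].
  by have := rEk g; rewrite rk0 gk.
have two (F : option 'I_n -> rat) : (forall k, k != i -> k != j -> F k = 0) ->
    \sum_k F k = F i + F j.
  move=> F0; rewrite (bigD1 i) //= (bigD1 j) 1?eq_sym //= big1 ?addr0 //.
  by move=> k /andP[ki kj]; apply: F0.
rewrite two in ta => [|k ki kj]; last by rewrite t0 ?mul0r.
rewrite two in tb => [|k ki kj]; last by rewrite t0 ?mul0r.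
apply/eqP; apply: contraT => sl.
have ti : t i = 0.
  have : t i * act (r i) a * (slope i - slope j) = 0.
    have -> : t i * act (r i) a * (slope i - slope j) =
      (t i * act (r i) a * slope i + t j * act (r j) a * slope j) -
      (t i * act (r i) a + t j * act (r j) a) * slope j by ring.
    by rewrite ta tb mul0r subrr.
  by move/eqP; rewrite !mulf_eq0 (negPf ria) subr_eq0 (negPf sl) !orbF => /eqP.
have tj : t j = 0.
  by move/eqP: ta; rewrite ti mul0r add0r mulf_eq0 (negPf rja) orbF => /eqP.
have [k fk] := cov f; move: yf; rewrite (tE k f fk).
have [->|ki] := eqVneq k i; first by rewrite ti mul0r eqxx.
have [->|kj] := eqVneq k j; first by rewrite tj mul0r eqxx.
by rewrite t0 // mul0r eqxx.
Qed.

Section EdgeStrand.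

Variable e1 : option 'I_n.
Hypothesis e1_edge : l e1 = [::].

Lemma edge_strand : exists e, pedges (strand e1) = [set e] /\ ends e = [set a; b].
Proof.
have [us dis lk cov _] := th.
have abs : [set a; b] \in consec (strand e1).
  by rewrite /strand e1_edge /= consec_cons !inE eqxx.
have [e eE] := lk e1 _ abs; exists e; split=> //; apply/setP => f; rewrite in_set1.
rewrite inE /strand e1_edge /= consec_cons consec1 setU0 in_set1 -eE.
exact: (inj_eq ends_injective).
Qed.

Lemma strand_share i j (Ci Cj : subgraph D) e : i != e1 -> j != e1 -> i != j ->
    pedges (strand e1) = [set e] -> ends e = [set a; b] ->
    edges Ci = pedges (strand e1) :|: pedges (strand i) ->
    verts Ci = [set v in strand e1 ++ strand i] ->
    edges Cj = pedges (strand e1) :|: pedges (strand j) ->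
    verts Cj = [set v in strand e1 ++ strand j] ->
  share_edge e Ci Cj.
Proof.
have [us dis lk cov _] := th.
move=> ie je ij pe ee eCi vCi eCj vCj; split.
  rewrite vCi vCj ee; apply/setP => v; rewrite in_setI in_set2 !in_set !mem_cat.
  rewrite !mem_strand e1_edge in_nil orbF.
  case: (v == a) => //=; case: (v == b) => //=.
  by apply/negbTE/negP => /andP[vi]; apply/negP; apply: dis vi.
rewrite eCi eCj -pe; apply/setP => f; rewrite in_setI !in_setU.
have [//|fe] := boolP (f \in pedges (strand e1)) => /=.
apply/negbTE/negP => /andP[fi fj]; move/eqP: ij; apply.
exact: (strand_disjoint th fi fj).
Qed.

Lemma theta_D1 i j : i != e1 -> j != e1 -> i != j -> slope i = slope e1 ->
  slope j = slope e1 -> exists H : subgraph D, type_D1 H.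
Proof.
move=> ie je ij si sj; have [e [pe ee]] := edge_strand.
have [Ci [ci eCi vCi]] := theta_cycle th (i := e1) (j := i) ltac:(by rewrite eq_sym).
have [Cj [cj eCj vCj]] := theta_cycle th (i := e1) (j := j) ltac:(by rewrite eq_sym).
have sub f : f \in edges Ci :|: edges Cj -> ends f \subset verts Ci :|: verts Cj.
  rewrite in_setU => /orP[]/ends_sub fs; apply: subset_trans fs _.
    exact: subsetUl.
  exact: subsetUr.
exists (Subgraph sub), e, Ci, Cj; split=> //.
- by split=> //; rewrite (theta_balanced ci _ eCi) ?si // eq_sym.
- by split=> //; rewrite (theta_balanced cj _ eCj) ?sj // eq_sym.
- exact: (strand_share ie je ij pe ee eCi vCi eCj vCj).
Qed.

(** The strands [i], [j] and [k], each closed by the edge of [e1], are the three cycles sharing this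
    edge, and [j] with [k] forms the fourth one. *)
Lemma theta_D2 i j k : i != e1 -> j != e1 -> k != e1 -> slope i = slope e1 ->
  slope j != slope e1 -> slope k != slope e1 -> slope j != slope k ->
  exists H : subgraph D, type_D2 H.
Proof.
move=> ie je ke si sj sk sjk; have [e [pe ee]] := edge_strand.
have ij : i != j by apply: contraNneq sj => <-; rewrite si.
have ik : i != k by apply: contraNneq sk => <-; rewrite si.
have jk : j != k by apply: contraNneq sjk => ->.
have [Ci [ci eCi vCi]] := theta_cycle th (i := e1) (j := i) ltac:(by rewrite eq_sym).
have [Cj [cj eCj vCj]] := theta_cycle th (i := e1) (j := j) ltac:(by rewrite eq_sym).
have [Ck [ck eCk vCk]] := theta_cycle th (i := e1) (j := k) ltac:(by rewrite eq_sym).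
have [Cl [cl eCl vCl]] := theta_cycle th jk.
have sub f : f \in edges Ci :|: edges Cj :|: edges Ck ->
    ends f \subset verts Ci :|: verts Cj :|: verts Ck.
  rewrite !in_setU => /orP[/orP[]|]/ends_sub fs; apply: subset_trans fs _;
  by apply/subsetP => v vC; rewrite !in_setU vC ?orbT.
exists (Subgraph sub), e, Ci, Cj, Ck, Cl; split=> //.
- by split=> //; rewrite (theta_balanced ci _ eCi) ?si // eq_sym.
- by split=> //; [rewrite (theta_balanced cj _ eCj) | rewrite (theta_balanced ck _ eCk)];
    rewrite // eq_sym.
- split.
  + exact: (strand_share ie je ij pe ee eCi vCi eCj vCj).
  + exact: (strand_share ie ke ik pe ee eCi vCi eCk vCk).
  + exact: (strand_share je ke jk pe ee eCj vCj eCk vCk).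
split=> //; last by rewrite (theta_balanced cl jk eCl).
have notin m : m != e1 -> (e \in pedges (strand m)) = false.
  move=> me; apply/negbTE; apply: contra me => em; apply/eqP.
  by apply: (strand_disjoint th em); rewrite pe in_set1.
rewrite eCl eCj eCk pe; apply/setP => f; rewrite in_setD1 !in_setU in_set1.
by have [->|//] := eqVneq f e; rewrite !notin.
Qed.

End EdgeStrand.

(* Off an edge strand, semiconformal decompositions are conformal since a strand
   with an interior vertex carries entries of both signs; an edge strand inherits
   the signs from one other strand. *)
Lemma theta_binomial_fibers :
    (0 < n)%N -> ~ (exists H : subgraph D, type_D1 H) ->
    ~ (exists H : subgraph D, type_D2 H) ->
    (#|[set i | slope (Some i) != slope None]| <= 2)%N ->
  binomial_fibers amon.
Proof.
move=> n0 noD1 noD2 le2 u v w uv Ew; have [ne E' _] := uv; have [us dis lk cov emp] := th.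
have cop f : u f = 0%N \/ v f = 0%N.
  have [u0f|uf] := eqVneq (u f) 0%N; [by left|right]; apply/eqP/negPn/negP => vf.
  have := @primitive_coprime _ _ amon u v U_(f)%MM uv.
  by rewrite !lep1mP => /(_ uf vf)/eqP; rewrite mnm1_eq0.
pose x f : rat := (u f)%:R - (w f)%:R; pose y f : rat := (w f)%:R - (v f)%:R.
have x0 : forall k : V, act x k = 0 by apply/adeg_actP; rewrite Ew.
have y0 : forall k : V, act y k = 0 by apply/adeg_actP; rewrite Ew E'.
(* Where [u] exceeds [w], [v] vanishes by coprimality, so [w - v] is not negative. *)
have semi f : ~ (x f > 0 /\ y f < 0).
  rewrite /x /y => -[]; have wf : 0 <= (w f)%:R :> rat by rewrite ler0n.
  by case: (cop f) => ->; lra.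
have [t [tE ta tb]] := theta_kernel x0; have [t' [t'E t'a t'b]] := theta_kernel y0.
(* As the strand vector has entries of both signs, coefficients [t i] and [t' i] of opposite signs
   would violate [semi] at one of them. *)
have conf i : l i != [::] -> 0 <= t i * t' i.
  move=> li; have [f [g [rf rg]]] := strand_signs li; have [rE _ _ _ _] := rP i.
  have fi : f \in pedges (strand i) by rewrite -rE gt_eqF.
  have gi : g \in pedges (strand i) by rewrite -rE lt_eqF.
  have := semi f; have := semi g; rewrite (tE i f fi) (t'E i f fi) (tE i g gi) (t'E i g gi).
  move=> ng nf; rewrite leNgt; apply/negP => tt.
  have [tpos|tneg|teq] := ltgtP 0 (t i); last by rewrite -teq mul0r ltxx in tt.
    apply: nf; split; first exact: mulr_gt0.
    have : t' i < 0 by nra.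
    by move=> t'n; nra.
  apply: ng; split; first by nra.
  have : t' i > 0 by nra.
  by move=> t'n; nra.
have all_conf i : 0 <= t i * t' i.
  have [li|/conf//] := eqVneq (l i) [::].
  have [|||r1 [c [ir cs cE]]] := @slope_pattern n slope i n0.
  - move=> j k ji ki jk sj; apply/eqP => sk; apply: noD1.
    exact: (theta_D1 li ji ki jk sj sk).
  - move=> j k m ji ki mi sj sk sm; apply/eqP; apply: contraT => skm; case: noD2.
    exact: (theta_D2 li ji ki mi sj sk sm skm).
  - exact: le2.
  (* At most one strand is a single edge, so [r1] has an interior vertex, and its sign condition
     passes on to [i]. *)
  have r1l : l r1 != [::] by apply: contraNneq ir => lr; apply/eqP/emp.
  have [_ _ ra _ _] := rP r1; have [_ _ ia _ _] := rP i.
  have sq k : t k * act (r k) a * (t' k * act (r k) a) = t k * t' k * act (r k) a ^+ 2.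
    by rewrite mulrACA -expr2.
  have := slope_signs ir cs cE ta tb t'a t'b; rewrite !sq => H.
  have /H : 0 <= t r1 * t' r1 * act (r r1) a ^+ 2 by rewrite mulr_ge0 ?sqr_ge0 ?conf.
  by rewrite pmulr_lge0 // lt_def sqr_ge0 sqrf_eq0 ia.
(* Now [u - w] and [w - v] never have opposite signs, which bounds [w] by [u + v]. *)
apply: (primitive_le_add uv Ew); apply/mnm_lepP => f; rewrite mnmDE -(ler_nat rat) natrD.
have [i fi] := cov f; have := all_conf i.
have : 0 <= x f * y f.
  rewrite (tE i f fi) (t'E i f fi) mulrACA -expr2 mulr_ge0 ?sqr_ge0 //.
have uf : 0 <= (u f)%:R :> rat by rewrite ler0n.
have vf : 0 <= (v f)%:R :> rat by rewrite ler0n.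
rewrite /x /y => xy _; rewrite leNgt; apply/negP => lt.
have : (u f)%:R - (w f)%:R < 0 :> rat by lra.
have : (w f)%:R - (v f)%:R > 0 :> rat by lra.
by nra.
Qed.

End ThetaKernel.

End Incidence.

Theorem theorem3p23 (K : fieldType) (D : wograph) (n : nat)
    (P : subgraph D) (C : 'I_n -> subgraph D)
    (n_gt0 : (0 < n)%N)
    (defD : union_along_path P C)
    (unbalanced_le2 : (#|[set i | ~~ balanced (C i)]| <= 2)%N) :
  [<-> strongly_robust K D;
       robust K D;
       generalized_robust K D;
       weakly_robust K D;
       ~ (exists H : subgraph D, type_D1 H) /\
       ~ (exists H : subgraph D, type_D2 H)].
Proof.
have [a [b [l [th CE]]]] := union_along_path_theta n_gt0 defD.
have [r rP] := strand_vectors th.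
have balE i : balanced (C i) = (slope a b r None == slope a b r (Some i)).
  by have [cyc _ _ _ _] := defD; apply: (theta_balanced th rP).
have yes : ~ (exists H : subgraph D, type_D1 H) /\ ~ (exists H : subgraph D, type_D2 H) ->
    [/\ strongly_robust K D, robust K D, generalized_robust K D & weakly_robust K D].
  move=> [noD1 noD2]; have fib : binomial_fibers (@amon D).
    apply: (theta_binomial_fibers th rP) => //; apply: leq_trans unbalanced_le2.
    by apply/eq_leq/eq_card => i; rewrite !inE balE eq_sym.
  rewrite /strongly_robust /robust /generalized_robust /weakly_robust toric_idealE; split.
  - exact: (binomial_fibers_strongly_robust K fib).
  - exact: (binomial_fibers_robust K (@amon_neq0 D) fib).
  - exact: (binomial_fibers_generalized_robust (@amon_neq0 D) fib).
  - exact: (binomial_fibers_weakly_robust fib).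
have no : not_robust D K \/
    (~ (exists H : subgraph D, type_D1 H) /\ ~ (exists H : subgraph D, type_D2 H)).
  have [[H HD1]|noD1] := classic (exists H : subgraph D, type_D1 H).
    by left; apply: type_D1_not_robust HD1.
  have [[H HD2]|noD2] := classic (exists H : subgraph D, type_D2 H).
    by left; apply: type_D2_not_robust HD2.
  by right.
(* Either all four robustness properties fail, or both types are absent and all four hold; this
   settles each implication, with [yes] leading back from the last condition. *)
by tfae=> [|||?|/yes[]//]; case: no => [[]//|noD]; case: (yes noD).
Qed.
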